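(* Let $\mathfrak g$ be the $n$-dimensional Lie algebra of a torus $G$ of dimension $n$, and let $\Delta\subseteq\mathfrak g^*$ be an $n$-dimensional unimodular polytope. Let $F$ be a (nonempty) $k$-dimensional face of $\Delta$ with $0\le k\le n-2$, let $\xi_1,\dots,\xi_m$ be the vertices of $F$, and let $F_1,\dots,F_{n-k}$ be the facets of $\Delta$ containing $F$. Let $w_1,\dots,w_{n-k}\in\mathfrak g_{\mathbb Z}$ be the corresponding primitive inward conormals and $c_i:=\langle\xi,w_i\rangle$ for $\xi\in F_i$. For each vertex $\xi_j$ of $F$, let $\beta_{j,1},\dots,\beta_{j,n-k}\in\mathfrak g_{\mathbb Z}^*$ be the primitive vectors along the edges of $\Delta$ emanating from $\xi_j$ that are not contained in $F$, indexed so that $\langle\beta_{j,i},w_r\rangle=\delta_{ir}$ for $1\le i,r\le n-k$. For $\varepsilon>0$ set $$w_F:=w_1+\cdots+w_{n-k},\qquad c_F:=c_1+\cdots+c_{n-k},$$ $$A_F^\varepsilon:=\{\xi\in\mathfrak g^*\mid\langle\xi,w_F\rangle=c_F+\varepsilon\},\qquad \mathcal V_F^\varepsilon:=\{\xi_j+\varepsilon\beta_{j,i}\mid j=1,\dots,m,\ i=1,\dots,n-k\}.$$ Then: (1) $w_F$ is a primitive element of $\mathfrak g_{\mathbb Z}$; (2) $\mathcal V_F^\varepsilon$ lies on the affine hyperplane $A_F^\varepsilon$; (3) for $\varepsilon$ sufficiently small, $A_F^\varepsilon$ intersects $\Delta$ integrally transversely and $A_F^\varepsilon\cap\Delta$ is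 the unimodular polytope with vertex set $\mathcal V_F^\varepsilon$.
   Context: $\mathfrak g_{\mathbb Z}=\ker(\exp:\mathfrak g\to G)$ is the integral lattice and $\mathfrak g_{\mathbb Z}^*=\{\xi\in\mathfrak g^*\mid \xi(\mathfrak g_{\mathbb Z})\subseteq\mathbb Z\}$ the dual (weight) lattice. A lattice vector is primitive if it is nonzero and not an integer multiple $\geq 2$ of another lattice vector. The primitive inward conormal of a facet $F_i$ is the primitive $w_i\in\mathfrak g_{\mathbb Z}$ such that, for the constant value $c_i$ of $\langle\cdot,w_i\rangle$ on $F_i$, $\Delta\subseteq\{\xi\mid\langle\xi,w_i\rangle\ge c_i\}$ and $F_i=\Delta\cap\{\xi\mid\langle\xi,w_i\rangle=c_i\}$. For a polytope $\Delta\subseteq\mathfrak g^*$ and $\xi\in\Delta$: the local cone is $C_\xi\Delta=\mathrm{Cone}(\Delta-\xi)$ (conic hull); if $F'$ is the unique face containing $\xi$ in its relative interior, $L_\xi\Delta=\mathrm{Span}_{\mathbb R}(F'-\xi)$; $\mathrm{dir}(\Delta)$ is the linear subspace of which the affine hull of $\Delta$ is a translate. $\Delta$ is rational if it is an intersection of finitely many half-spaces $\{\xi\mid\langle\xi,v_i\rangle\ge c_i\}$ with $v_i\in\mathfrak g_{\mathbb Z}$, $c_i\in\mathbb R$. A rational polytope $\Delta$ is unimodular if for every vertex $\xi$ the cone $C_\xi\Delta$ is the conic hull of a $\mathbb Z$-basis of $\mathfrak g_{\mathbb Z}^*\cap\mathrm{dir}(\Delta)$. For an $n$-dimensional unimodular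 $\Delta$, the primitive edge vectors at a vertex $\xi_j$ of $F$ form a $\mathbb Z$-basis of $\mathfrak g_{\mathbb Z}^*$ whose dual basis consists of the primitive inward conormals of the $n$ facets through $\xi_j$; hence the required indexing of the $\beta_{j,i}$ exists and is unique. A translate $A$ of a rational subspace $B$ (one spanned by $B\cap\mathfrak g_{\mathbb Z}^*$) intersects a rational polytope $\Delta$ integrally transversely if for every $\xi\in A\cap\Delta$ $$(B\cap\mathfrak g_{\mathbb Z}^* )+(L_\xi\Delta\cap\mathfrak g_{\mathbb Z}^* )=(B\cap\mathfrak g_{\mathbb Z}^* )+(\mathrm{dir}(\Delta)\cap\mathfrak g_{\mathbb Z}^* ).$$ *)

(* Defs.v *)
From mathcomp Require Import all_boot all_order all_algebra.
From mathcomp Require Import all_classical all_reals.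

Set Implicit Arguments.
Unset Strict Implicit.
Unset Printing Implicit Defensive.

Import Order.TTheory GRing.Theory Num.Theory.
Local Open Scope classical_set_scope.
Local Open Scope ring_scope.

Section Hulls.
Variables (R : realType) (V : vectType R).
Implicit Types (K : set R) (A D F : set V) (x v : V).

Definition lin_hull K A : set V :=
  [set x | exists m (a : 'I_m -> R) (v : 'I_m -> V),
     (forall i, K (a i) /\ A (v i)) /\ x = \sum_i a i *: v i].

Definition aff_comb K A : set V :=
  [set x | exists m (a : 'I_m -> R) (v : 'I_m -> V),
     [/\ forall i, K (a i) /\ A (v i), \sum_i a i = 1 &
         x = \sum_i a i *: v i]].

Definition Rspan := lin_hull setT.
Definition Zspan := lin_hull [set a | a \is a Num.int].
Definition conic_hull := lin_hull [set a | 0 <= a].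
Definition affine_hull := aff_comb setT.
Definition convex_hull := aff_comb [set a | 0 <= a].

Definition sumset A D : set V := [set x + y | x in A & y in D].
Definition translate A x : set V := [set v + x | v in A].

Definition dir A : set V :=
  [set v | exists x y, [/\ affine_hull A x, affine_hull A y & v = y - x]].

(* Never holds for A = set0, whose [dir] is empty. *)
Definition has_dim A (d : nat) : Prop :=
  exists2 U : {vspace V}, dir A = [set` U] & \dim U = d.

(* Interior of A in its affine hull; the topology of V is that of the
   sup norm with respect to a basis, on which it does not depend. *)
Definition rel_interior A : set V :=
  [set x | A x /\ exists2 e : R, 0 < e & forall y, affine_hull A y ->
     (forall i, `|coord (vbasis {:V}) i (y - x)| < e) -> A y].

Definition polytope D : Prop := exists s : seq V, D = convex_hull [set` s].

Definition face D F : Prop :=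
  exists (l : 'Hom(V, R^o)) (c : R),
    D `<=` [set x | c <= l x] /\ F = D `&` [set x | l x = c].

Definition vertex D x : Prop := face D [set x].
Definition edge D F : Prop := face D F /\ has_dim F 1.
Definition facet D F : Prop :=
  face D F /\ exists2 d, has_dim D d.+1 & has_dim F d.

Definition local_cone x D : set V := conic_hull (translate D (- x)).

(* The face F is uniquely determined by x when D is a polytope. *)
Definition local_lin x D : set V :=
  [set v | exists F, [/\ face D F, rel_interior F x &
                         Rspan (translate F (- x)) v]].

Definition primitive (L : set V) x : Prop :=
  [/\ L x, x != 0 & forall (k : nat) y, (2 <= k)%N -> L y -> x <> y *+ k].

Definition is_Zbasis (L : set V) r (b : 'I_r -> V) : Prop :=
  L = Zspan (range b) /\
  forall z : 'I_r -> int, \sum_i (z i)%:~R *: b i = 0 -> forall i, z i = 0.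

(* b is the primitive vector of the lattice L along the edge E of D, pointing
   away from the vertex x. *)
Definition edge_vector (L : set V) D x E b : Prop :=
  [/\ edge D E, E x, primitive L b & exists2 t : R, 0 < t & E (x + t *: b)].

End Hulls.

Definition dual_space (R : realType) (g : vectType R) : vectType R :=
  'Hom(g, R^o).

(* A torus G with Lie algebra g is recorded through its exponential map: a
   surjective group morphism g -> G whose kernel is a full-rank lattice of g,
   so that G = g / ker exp. *)
Definition torus_exp (R : realType) (g : vectType R) (G : zmodType)
    (expG : {additive g -> G}) : Prop :=
  (forall y : G, exists x : g, expG x = y) /\
  exists2 b : (\dim {:g}).-tuple g, basis_of {:g} b &
    [set x | expG x = 0] = Zspan [set` b].

Section Lattice.
Variables (R : realType) (g : vectType R).
Variables (G : zmodType) (expG : {additive g -> G}).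
Implicit Types (D A : set (dual_space g)) (B : {vspace dual_space g}).

Definition int_lattice : set g := [set x | expG x = 0].

Definition weight_lattice : set (dual_space g) :=
  [set xi | forall x, int_lattice x -> xi x \is a Num.int].

Definition rational D : Prop :=
  exists m (v : 'I_m -> g) (c : 'I_m -> R),
    (forall i, int_lattice (v i)) /\
    D = [set xi : dual_space g | forall i, c i <= xi (v i)].

Definition unimodular D : Prop :=
  [/\ polytope D, rational D &
   forall xi, vertex D xi -> exists r (b : 'I_r -> dual_space g),
     is_Zbasis (weight_lattice `&` dir D) b /\
     local_cone xi D = conic_hull (range b)].

Definition rational_subspace B : Prop :=
  [set` B] = Rspan ([set` B] `&` weight_lattice).

Definition integrally_transverse A D : Prop :=
  exists (B : {vspace dual_space g}) (a : dual_space g),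
    [/\ rational_subspace B, A = translate [set` B] a &
     forall xi, (A `&` D) xi ->
       sumset ([set` B] `&` weight_lattice)
              (local_lin xi D `&` weight_lattice) =
       sumset ([set` B] `&` weight_lattice) (dir D `&` weight_lattice)].

Definition inward_conormal D (H : set (dual_space g)) (w : g) (c : R) : Prop :=
  [/\ primitive int_lattice w,
      D `<=` [set xi : dual_space g | c <= xi w] &
      H = D `&` [set xi : dual_space g | xi w = c]].

End Lattice.

(* Main.v *)
(* At a vertex p of Delta, unimodularity provides a Z-basis (b_i) of the weight
   lattice such that Delta lies in p + Cone(b) and contains each p + s b_i for
   some s > 0; call this a chart at p. For a vertex p of F, the generators lying
   in F are killed by every w_r, while each of the others spans an edge leaving
   F, so it is one of the beta's. Hence w_F takes the value 0 on the former and
   1 on the latter, and all of the local assertions at p + e beta can be read in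
   the chart: its section by w_F = c_F + e is generated by the
   b_i - <b_i, w_F> beta.

   Globally, the section is a bounded polyhedron, so it is the convex hull of its
   extreme points. Write such a point x as a convex combination of vertices of
   Delta. One of them, with positive weight, has level at most c_F + e; for e
   small it belongs to F. In the chart at that vertex, x can be moved both ways
   along each generator it involves, so by extremality it involves only one,
   and x = p + e beta.

   For transversality, a point x of the section involves some p + e beta with
   positive weight, so beta is in L_x Delta; as <beta, w_F> = 1, beta generates a
   complement in the weight lattice of the part lying in the kernel of w_F. *)

Require Import Defs.
From mathcomp Require Import all_boot all_order all_algebra.
From mathcomp Require Import all_classical all_reals.
From HB Require Import structures.
From mathcomp Require Import ring lra.

Set Implicit Arguments.
Unset Strict Implicit.
Unset Printing Implicit Defensive.

Import Order.TTheory GRing.Theory Num.Theory.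
Local Open Scope classical_set_scope.
Local Open Scope ring_scope.

(** * Linear functionals and the identities they detect *)

Section Functionals.
Variables (R : realType) (V : vectType R).
Implicit Types (l : 'Hom(V, R^o)) (x y : V) (a : R).

Lemma homD l x y : l (x + y) = l x + l y :> R. Proof. by rewrite linearD. Qed.
Lemma homN l x : l (- x) = - l x :> R. Proof. by rewrite linearN. Qed.
Lemma hom0 l : l 0 = 0 :> R. Proof. by rewrite linear0. Qed.
Lemma homZ l a x : l (a *: x) = a * l x :> R. Proof. by rewrite linearZ. Qed.
Lemma hom_sum l I (r : seq I) (P : pred I) (F : I -> V) :
  l (\sum_(i <- r | P i) F i) = \sum_(i <- r | P i) l (F i) :> R.
Proof. by rewrite linear_sum. Qed.

Definition homE := (homD, homN, hom0, homZ).

(** Turns an identity between vectors into one between reals, where [ring] and [field] apply. *)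
Lemma hom_ext x y : (forall l, l x = l y :> R) -> x = y.
Proof.
move=> h; rewrite (coord_vbasis (memvf x)) (coord_vbasis (memvf y)).
apply: eq_bigr => i _; congr (_ *: _).
by have := h (linfun (coord (vbasis {:V}) i : V -> R^o)); rewrite !lfunE.
Qed.

End Functionals.

(** * Linear, affine and convex hulls; faces, extreme points and directions *)

Section Hulls.
Variables (R : realType) (V : vectType R).
Implicit Types (K : set R) (A D F : set V) (x v : V) (l : 'Hom(V, R^o)).

Lemma lin_hull_min K A (Q : set V) : Q 0 ->
  (forall a v y, K a -> A v -> Q y -> Q (a *: v + y)) ->
  lin_hull K A `<=` Q.
Proof.
move=> Q0 QD _ [m [a [v [h ->]]]]; elim/big_rec: _ => // i y _ Qy.
by have [Ka Av] := h i; exact: QD.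
Qed.

Lemma lin_hull0 K A : lin_hull K A 0.
Proof.
by exists 0%N, (fun=> 0), (fun=> 0); split; [case|rewrite big_ord0].
Qed.

Lemma lin_hull_gen K A a v : K a -> A v -> lin_hull K A (a *: v).
Proof.
move=> Ka Av; exists 1%N, (fun=> a), (fun=> v); split => //.
by rewrite big_ord1.
Qed.

Lemma lin_hullD K A x y : lin_hull K A x -> lin_hull K A y ->
  lin_hull K A (x + y).
Proof.
move=> [m [a [v [h ->]]]] [p [b [u [k ->]]]].
exists (m + p)%N,
  (fun i : 'I_(m + p) =>
     match fintype.split i with inl i => a i | inr i => b i end),
  (fun i : 'I_(m + p) =>
     match fintype.split i with inl i => v i | inr i => u i end); split.
  by move=> i; case: (fintype.split i).
rewrite big_split_ord /=; congr (_ + _); apply: eq_bigr => i _.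
  by rewrite (unsplitK (inl i : 'I_m + 'I_p)).
by rewrite (unsplitK (inr i : 'I_m + 'I_p)).
Qed.

Lemma lin_hull_sum K A (I : Type) (r : seq I) (P : pred I) (F : I -> V) :
  (forall i, P i -> lin_hull K A (F i)) ->
  lin_hull K A (\sum_(i <- r | P i) F i).
Proof.
move=> h; elim/big_ind: _ => //; first exact: lin_hull0.
exact: lin_hullD.
Qed.

Lemma lin_hullZ K A b x : (forall a, K a -> K (b * a)) ->
  lin_hull K A x -> lin_hull K A (b *: x).
Proof.
move=> Kb; apply: (@lin_hull_min K A [set x | lin_hull K A (b *: x)]) => /=.
  by rewrite scaler0; exact: lin_hull0.
move=> a v y Ka Av hy; rewrite scalerDr scalerA; apply: lin_hullD => //.
by apply: lin_hull_gen => //; exact: Kb.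
Qed.

Lemma lin_hull_trans K A D : (forall a b, K a -> K b -> K (a * b)) ->
  A `<=` lin_hull K D -> lin_hull K A `<=` lin_hull K D.
Proof.
move=> KM AD; apply: lin_hull_min; first exact: lin_hull0.
move=> a v y Ka Av hy; apply: lin_hullD => //.
by apply: lin_hullZ (AD _ Av) => b Kb; exact: KM.
Qed.

Definition convex_set D :=
  forall x y (a : R), 0 <= a -> a <= 1 -> D x -> D y -> D (a *: x + (1 - a) *: y).

(** Terms are added one at a time, renormalising by the running total. The induction keeps the case
    of total weight zero apart, as it cannot be normalised. *)
Lemma convex_sum D I (r : seq I) (P : pred I) (a : I -> R) (v : I -> V) :
  convex_set D -> (forall i, P i -> 0 <= a i) ->
  (forall i, P i -> 0 < a i -> D (v i)) ->
  let s := \sum_(i <- r | P i) a i in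
  0 < s -> D (s^-1 *: \sum_(i <- r | P i) a i *: v i).
Proof.
move=> cD a0 Dv /= s_gt0.
suff: \sum_(i <- r | P i) a i = 0 /\ \sum_(i <- r | P i) a i *: v i = 0 \/
    0 < \sum_(i <- r | P i) a i /\
    D ((\sum_(i <- r | P i) a i)^-1 *: \sum_(i <- r | P i) a i *: v i).
  by case=> -[] // s0 _; rewrite s0 ltxx in s_gt0.
elim/big_rec2: _ => [|i y s Pi IH]; first by left.
have := a0 i Pi; rewrite le_eqVlt => /predU1P[<-|ai0].
  by rewrite scale0r !add0r.
right; case: IH => [[-> ->]|[s0 Dy]].
  by rewrite !addr0 scalerA mulVf ?gt_eqF// scale1r; split => //; exact: Dv.
have as0 : 0 < a i + s by rewrite addr_gt0.
split => //; have -> : (a i + s)^-1 *: (a i *: v i + y) =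
    (a i / (a i + s)) *: v i + (1 - a i / (a i + s)) *: (s^-1 *: y).
  apply: hom_ext => l; rewrite !homE; field.
  by rewrite !gt_eqF.
apply: cD => //; last exact: Dv.
- by rewrite divr_ge0 ?ltW.
- by rewrite ler_pdivrMr // mul1r lerDl ltW.
Qed.

Lemma convex_hull_min A D : convex_set D -> A `<=` D -> convex_hull A `<=` D.
Proof.
move=> cD AD _ [m [a [v [h s1 ->]]]].
have /= := @convex_sum D _ (index_enum 'I_m) xpredT a v cD
  (fun i _ => proj1 (h i)) (fun i _ _ => AD _ (proj2 (h i))).
by rewrite s1 invr1 scale1r; apply; exact: ltr01.
Qed.

Lemma aff_comb_gen K A : K 1 -> A `<=` aff_comb K A.
Proof.
move=> K1 x Ax; exists 1%N, (fun=> 1), (fun=> x).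
by rewrite !big_ord1 scale1r.
Qed.

Lemma aff_comb_mix K A (a b : R) x y :
  (forall c, K c -> K (a * c)) -> (forall c, K c -> K (b * c)) -> a + b = 1 ->
  aff_comb K A x -> aff_comb K A y -> aff_comb K A (a *: x + b *: y).
Proof.
move=> Ka Kb ab [m [c [v [h c1 ->]]]] [p [d [u [k d1 ->]]]].
exists (m + p)%N,
  (fun i : 'I_(m + p) =>
     match fintype.split i with inl i => a * c i | inr i => b * d i end),
  (fun i : 'I_(m + p) =>
     match fintype.split i with inl i => v i | inr i => u i end).
have sl i : fintype.split (lshift p i : 'I_(m + p)) = inl i.
  exact: (unsplitK (inl i : 'I_m + 'I_p)).
have sr i : fintype.split (rshift m i : 'I_(m + p)) = inr i.
  exact: (unsplitK (inr i : 'I_m + 'I_p)).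
split.
- move=> i; case: (fintype.split i) => j.
    by have [? ?] := h j; split => //; exact: Ka.
  by have [? ?] := k j; split => //; exact: Kb.
- rewrite big_split_ord /=.
  under eq_bigr do rewrite sl.
  under [X in _ + X]eq_bigr do rewrite sr.
  by rewrite -!mulr_sumr c1 d1 !mulr1.
- rewrite big_split_ord /= !scaler_sumr; congr (_ + _); apply: eq_bigr => i _.
    by rewrite sl scalerA.
  by rewrite sr scalerA.
Qed.

Lemma convex_convex_hull A : convex_set (convex_hull A).
Proof.
move=> x y a a0 a1; apply: aff_comb_mix => /=; last by rewrite addrC subrK.
- by move=> c c0; rewrite mulr_ge0.
- by move=> c c0; rewrite mulr_ge0 // subr_ge0.
Qed.

Lemma convex_hull_gen A : A `<=` convex_hull A.
Proof. by apply: aff_comb_gen; rewrite /= ler01. Qed.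

Lemma affine_hull_gen A : A `<=` affine_hull A.
Proof. exact: aff_comb_gen. Qed.

Lemma affine_hull_eq A l c : (forall x, A x -> l x = c) ->
  forall x, affine_hull A x -> l x = c.
Proof.
move=> h _ [m [a [v [k s1 ->]]]]; rewrite hom_sum -[RHS]mul1r -s1 mulr_suml.
by apply: eq_bigr => i _; rewrite homZ h //; have [] := k i.
Qed.

Lemma convex_hull_le A l c : (forall x, A x -> l x <= c) ->
  forall x, convex_hull A x -> l x <= c.
Proof.
move=> h x; apply: (@convex_hull_min A [set x | l x <= c]) => // y z a a0 a1 /=.
by rewrite !homE; nra.
Qed.

(** An average cannot lie strictly below all the values that carry positive weight, so one such
    [v i] has level at most that of [x]; the other terms, renormalised, form [q]. *)
Lemma convex_hull_split A l x : convex_hull A x ->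
  exists p q a, [/\ 0 < a <= 1, A p, convex_hull A q, l p <= l x
    & x = a *: p + (1 - a) *: q].
Proof.
move=> Hx; have [m [a [v [h s1 xE]]]] := Hx.
have [[i ai li]|H] := pselect (exists2 i, 0 < a i & l (v i) <= l x).
  have ai1 : a i <= 1.
    by rewrite -s1 (bigD1 i) //= lerDl sumr_ge0 // => j _; have [] := h j.
  have Avi : A (v i) by have [] := h i.
  (* If [v i] carries the whole weight, nothing is left to renormalise; [q] then has coefficient
     zero and any point of the hull serves. *)
  have [ai1'|ai1'] := eqVneq (a i) 1.
    exists (v i), (v i), 1; split => //; first by rewrite ltr01 lexx.
      exact: convex_hull_gen.
    rewrite scale1r subrr scale0r addr0 xE (bigD1 i) //= ai1' scale1r.
    rewrite big1 ?addr0 // => j ji.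
    have /eqP : \sum_(j | j != i) a j = 0.
      by move: s1; rewrite (bigD1 i) //= ai1' => /(canRL (addKr _)) ->; rewrite addNr.
    rewrite psumr_eq0 => [/allP/(_ j)|k _]; last by have [] := h k.
    by rewrite mem_index_enum ji => /(_ isT)/= /eqP ->; rewrite scale0r.
  have sE : \sum_(j | j != i) a j = 1 - a i.
    by apply/eqP; rewrite eq_sym subr_eq -s1 (bigD1 i) //= addrC.
  have s0 : 0 < 1 - a i by rewrite subr_gt0 lt_neqAle ai1'.
  exists (v i), ((1 - a i)^-1 *: \sum_(j | j != i) a j *: v j), (a i).
  split; rewrite ?ai //.
    rewrite -sE; apply: convex_sum; rewrite ?sE //.
    - exact: convex_convex_hull.
    - by move=> j _; have [] := h j.
    - by move=> j _ _; apply: convex_hull_gen; have [] := h j.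
  by rewrite scalerA divff ?gt_eqF // scale1r xE (bigD1 i).
exfalso.
have lt_i i : 0 < a i -> l x < l (v i).
  by move=> ai; rewrite ltNge; apply/negP => li; apply: H; exists i.
have s0 : \sum_i a i * (l (v i) - l x) = 0.
  under eq_bigr do rewrite mulrBr.
  rewrite sumrB -mulr_suml s1 mul1r [in X in _ - X]xE hom_sum.
  by under [X in _ - X]eq_bigr do rewrite homZ; rewrite subrr.
have h0 i : 0 <= a i * (l (v i) - l x).
  have : 0 <= a i by have [] := h i.
  rewrite le_eqVlt => /predU1P[<-|ai]; first by rewrite mul0r.
  by rewrite mulr_ge0 ?ltW // subr_gt0 lt_i.
have a_eq0 i : a i = 0.
  apply/eqP/negP => /negP ai; have ai0 : 0 < a i.
    by rewrite lt_neqAle eq_sym ai; have [] := h i.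
  move/eqP: s0; rewrite psumr_eq0 // => /allP/(_ i).
  rewrite mem_index_enum => /(_ isT) /=; rewrite mulf_eq0 (negPf ai) /=.
  by rewrite subr_eq0 gt_eqF // lt_i.
by move: s1; rewrite big1 // => /eqP; rewrite eq_sym oner_eq0.
Qed.

(** Extreme points in midpoint form, which for convex [D] is the usual notion; a nonzero two-sided
    displacement refutes it. *)
Definition extreme D x := D x /\ forall u, D (x + u) -> D (x - u) -> u = 0.

Lemma vertex_extreme D x : vertex D x -> extreme D x.
Proof.
move=> [l [c [Dl xE]]].
have [Dx lx] : (D `&` [set y | l y = c]) x by rewrite -xE.
split => // u Du Dv.
have /Dl /= h1 := Du; have /Dl /= h2 := Dv.
have : (D `&` [set y | l y = c]) (x + u).
  by split => //=; move: lx h1 h2; rewrite /= !homE; lra.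
by rewrite -xE /= => /(canRL (addKr _)) ->; rewrite addNr.
Qed.

(** The functional defining the face is at its minimum at [x], so a displacement possible in both
    directions keeps it constant and stays in the face. *)
Lemma extreme_face D F x : face D F -> F x -> (extreme F x <-> extreme D x).
Proof.
move=> [l [c [Dl FE]]] Fx.
have [Dx lx] : (D `&` [set y | l y = c]) x by rewrite -FE.
split=> -[_ h]; split => // u Du Dv; last first.
  by move: Du Dv; rewrite FE => -[? _] [? _]; exact: h.
have /Dl /= h1 := Du; have /Dl /= h2 := Dv.
apply: h; rewrite FE; split => //=; move: lx h1 h2; rewrite /= !homE; lra.
Qed.

Lemma vertex_convex_hull A x : vertex (convex_hull A) x -> A x.
Proof.
move=> [l [c [Dl xE]]].
have [Hx lx] : (convex_hull A `&` [set y | l y = c]) x by rewrite -xE.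
have [p [q [a [_ Ap _ lp _]]]] := convex_hull_split l Hx.
have Hp := convex_hull_gen Ap.
suff : [set x] p by move=> <-.
rewrite xE; split => //=; apply/eqP; rewrite eq_le -{1}lx lp /=.
exact: Dl Hp.
Qed.

Lemma dirE A x : A x -> dir A = Rspan (translate A (- x)).
Proof.
move=> Ax; have Hx := affine_hull_gen Ax.
have sub y : affine_hull A y -> Rspan (translate A (- x)) (y - x).
  move=> [m [a [v [h s1 ->]]]].
  have -> : \sum_i a i *: v i - x = \sum_i a i *: (v i - x).
    under [RHS]eq_bigr do rewrite scalerBr.
    by rewrite sumrB -scaler_suml s1 scale1r.
  apply: lin_hull_sum => i _; apply: lin_hull_gen => //.
  by exists (v i) => //; have [] := h i.
apply/seteqP; split => [_ [y [z [Hy Hz ->]]]|u].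
  have -> : z - y = (z - x) + (-1) *: (y - x).
    by apply: hom_ext => l; rewrite !homE; ring.
  apply: lin_hullD; first exact: sub.
  by apply: lin_hullZ (sub _ Hy).
move=> Hu; exists x, (x + u); split => //; last by rewrite addrC addKr.
rewrite addrC; move: u Hu.
apply: (@lin_hull_min _ _ [set u | affine_hull A (u + x)]) => /=.
  by rewrite add0r.
move=> a _ y _ [z Az <-] Hy.
(* Two-point affine combinations suffice: take the midpoint of [y + x] and a point of the line
   through [x] and [z], then double its distance from [x]. *)
have -> : a *: (z - x) + y + x =
    2 *: (2^-1 *: (y + x) + 2^-1 *: (a *: z + (1 - a) *: x)) + (-1) *: x.
  by apply: hom_ext => l; rewrite !homE; field.
have Hz := affine_hull_gen Az.
by do 3! (apply: aff_comb_mix => //; try by field).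
Qed.

End Hulls.
Lemma small_all (R : realType) (I : finType) (Q : I -> R -> Prop) :
  (forall i, exists2 t : R, 0 < t & forall e, 0 < e -> e < t -> Q i e) ->
  exists2 t : R, 0 < t & forall i e, 0 < e -> e < t -> Q i e.
Proof.
move=> h.
suff [t t0 ht] : exists2 t : R, 0 < t &
    forall i e, i \in enum I -> 0 < e -> e < t -> Q i e.
  by exists t => // i e; apply: ht; rewrite mem_enum.
elim: (enum I) => [|j r [t t0 ht]]; first by exists 1; rewrite ?ltr01.
have [t' t'0 ht'] := h j.
exists (Num.min t t'); first by rewrite lt_min t0.
move=> i e; rewrite inE lt_min => /predU1P[->|ir] e0 /andP[et et'].
  exact: ht'.
exact: ht.
Qed.

(** * Polyhedra: active constraints, minimal faces and vertices *)

Section Polyhedra.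
Variables (R : realType) (V : vectType R) (M : nat).
Variables (l : 'I_M -> 'Hom(V, R^o)) (c : 'I_M -> R).
Implicit Types (x u : V) (t : R).

Definition polyhedron : set V := [set x | forall i, c i <= l i x].

(** For [x] in the polyhedron this is the smallest face through [x]. *)
Definition active_face x : set V :=
  polyhedron `&` [set y | forall i, l i x = c i -> l i y = c i].

(** The sum of the active constraints is a supporting functional: a sum of nonnegative slacks
    vanishes only if each slack does. *)
Lemma active_face_face x : face polyhedron (active_face x).
Proof.
exists (\sum_(i | l i x == c i) l i), (\sum_(i | l i x == c i) c i).
have le_ y : polyhedron y ->
    \sum_(i | l i x == c i) c i <= \sum_(i | l i x == c i) l i y.
  by move=> Dy; apply: ler_sum => i _; exact: Dy.
split; first by move=> y Dy /=; rewrite sum_lfunE; exact: le_.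
apply/seteqP; split=> y [Dy hy]; split=> //=; move: hy; rewrite /= sum_lfunE.
  by move=> hy; apply: eq_bigr => i /eqP; exact: hy.
move=> /eqP; rewrite -subr_eq0 -sumrB psumr_eq0; last first.
  by move=> i _; rewrite subr_ge0; exact: Dy.
move=> /allP h i ix; apply/eqP; rewrite -subr_eq0.
by have := h i; rewrite mem_index_enum ix eqxx => /(_ isT).
Qed.

Lemma active_dir x u i : polyhedron (x + u) -> polyhedron (x - u) ->
  l i x = c i -> l i u = 0.
Proof. by move=> /(_ i) + /(_ i); rewrite !homE; lra. Qed.

Lemma polyhedron_nbhs x u : polyhedron x -> (forall i, l i x = c i -> l i u = 0) ->
  exists2 t, 0 < t & forall e, 0 < e -> e < t ->
    polyhedron (x + e *: u) /\ polyhedron (x - e *: u).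
Proof.
move=> Dx hu.
have [|t t0 ht] := @small_all R 'I_M
    (fun i e => c i <= l i (x + e *: u) /\ c i <= l i (x - e *: u)).
  move=> i; have := Dx i; rewrite le_eqVlt => /predU1P[ci|ci].
    exists 1; first exact: ltr01.
    by move=> e _ _; rewrite !homE hu // mulr0 subr0 addr0 ci.
  have u0 := normr_ge0 (l i u).
  have u1 : 0 < `|l i u| + 1 by rewrite ltr_wpDl.
  exists ((l i x - c i) / (`|l i u| + 1)).
    by rewrite divr_gt0 ?subr_gt0.
  move=> e e0; rewrite ltr_pdivlMr // => he.
  have := ler_norm (l i u); have := ler_norm (- l i u); rewrite normrN !homE.
  by move=> h1 h2; split; nra.
by exists t => // e e0 et; split=> i; have [] := ht i e e0 et.
Qed.

(** Any other point [y] of the minimal face would allow small moves along [y - x] both ways, as this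
    direction keeps the active constraints tight. *)
Lemma extreme_vertex x : extreme polyhedron x -> vertex polyhedron x.
Proof.
move=> [Dx hx]; rewrite /vertex.
suff -> : [set x] = active_face x by exact: active_face_face.
apply/seteqP; split=> [_ ->|y [Dy hy]]; first by split.
have [i ix|t t0 ht] := @polyhedron_nbhs x (y - x) Dx.
  by rewrite !homE hy // ix subrr.
have [||h1 h2] := ht (t / 2); [by lra..|].
have /eqP := hx _ h1 h2; rewrite scaler_eq0 => /predU1P[|]; first by lra.
by rewrite subr_eq0 => /eqP.
Qed.

(** The witness is the minimal face through [x]. A two-sided displacement cannot change an active
    constraint, so [x + u] lies in that face; [x] is in its relative interior because inactive
    constraints survive small perturbations. *)
Lemma local_lin_polyhedron x u : polyhedron x -> polyhedron (x + u) ->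
  polyhedron (x - u) -> local_lin x polyhedron u.
Proof.
move=> Dx Du Dv; exists (active_face x); split.
- exact: active_face_face.
- split; first by split.
  have [|t t0 ht] := @small_all R 'I_M (fun i e => l i x != c i -> forall y,
      (forall k, `|coord (vbasis {:V}) k (y - x)| < e) -> c i <= l i y).
    move=> i; have [ci|ci] := eqVneq (l i x) (c i).
      by exists 1 => //; exact: ltr01.
    have {}ci : c i < l i x by rewrite lt_neqAle eq_sym ci; exact: Dx.
    (* [B] bounds [l i] on the unit ball of the coordinate sup norm, so a perturbation of size below
       [e] changes [l i] by at most [e * B]. *)
    set B := \sum_(k < \dim {:V}) `|l i (vbasis {:V})`_k|.
    have B1 : 0 < B + 1 by rewrite ltr_wpDl // sumr_ge0.
    exists ((l i x - c i) / (B + 1)).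
      by rewrite divr_gt0 ?subr_gt0.
    move=> e e0; rewrite ltr_pdivlMr // => he _ y hy.
    suff : `|l i (y - x)| <= e * B by rewrite ler_norml !homE; lra.
    rewrite [in l i _](coord_vbasis (memvf (y - x))) hom_sum.
    apply: le_trans (ler_norm_sum _ _ _) _; rewrite /B mulr_sumr.
    apply: ler_sum => k _; rewrite homZ normrM ler_wpM2r //.
    exact: ltW.
  exists (t / 2); first by lra.
  move=> y Hy hy.
  have tight i : l i x = c i -> l i y = c i.
    by move=> ix; apply: affine_hull_eq Hy => z [_]; exact.
  split=> // i; have [ix|ix] := eqVneq (l i x) (c i); first by rewrite tight.
  by apply: (ht i (t / 2) _ _ ix y hy); lra.
- rewrite -[u]scale1r; apply: lin_hull_gen => //.
  exists (x + u); last by rewrite addrC addKr.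
  by split=> // i ix; rewrite homD ix (active_dir Du Dv ix) addr0.
Qed.

(** * Bounded polyhedra and their extreme points *)

Section Bounded.
Variable s : seq V.
Hypothesis bounded : polyhedron `<=` convex_hull [set` s].

(** Otherwise the whole ray from [x] along [u] stays in the polyhedron, while a functional positive
    on [u] is bounded on the hull of [s]. *)
Lemma bounded_direction x u : polyhedron x -> u != 0 -> exists i, l i u < 0.
Proof.
move=> Dx u0; apply: contrapT => H.
have ge0 i : 0 <= l i u by rewrite leNgt; apply/negP => h; apply: H; exists i.
have [f fu] : exists f : 'Hom(V, R^o), 0 < f u.
  apply: contrapT => K; move/eqP: u0; apply; apply: hom_ext => f.
  rewrite hom0; apply/eqP; rewrite eq_le !leNgt; apply/andP; split; apply/negP => h.
    by apply: K; exists f.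
  by apply: K; exists (- f); rewrite opp_lfunE oppr_gt0.
pose B := \sum_(v <- s) `|f v|.
have fB y : polyhedron y -> f y <= B.
  move=> /bounded; apply: convex_hull_le => v /= vs.
  rewrite /B (perm_big _ (perm_to_rem vs)) big_cons /=.
  by rewrite (le_trans (ler_norm _)) // lerDl sumr_ge0.
have Bx := fB _ Dx.
suff /fB : polyhedron (x + ((B - f x + 1) / f u) *: u).
  by rewrite !homE divfK ?gt_eqF //; lra.
move=> i; rewrite !homE (le_trans (Dx i)) // lerDl mulr_ge0 //.
by rewrite divr_ge0 ?ltW //; lra.
Qed.

(** Follow [u] up to the first constraint it meets, found by a minimal ratio among those decreasing
    along [u]. It was inactive at [x], since active ones are constant along [u]. *)
Lemma exit_point x u : polyhedron x -> u != 0 ->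
  (forall i, l i x = c i -> l i u = 0) ->
  exists t i, [/\ 0 < t, polyhedron (x + t *: u), l i x != c i
    & l i (x + t *: u) = c i].
Proof.
move=> Dx u0 hu; have [i0 i0u] := bounded_direction Dx u0.
pose f i := (l i x - c i) / - l i u.
case: (@arg_minP _ _ _ i0 (fun i => l i u < 0) f) => // i iu imin.
have ix : l i x != c i by apply: contraTneq iu => /hu ->; rewrite ltxx.
exists (f i), i; split=> //.
- have {}ix : c i < l i x by rewrite lt_neqAle eq_sym ix; exact: Dx.
  by rewrite divr_gt0 ?subr_gt0 ?oppr_gt0.
- move=> j; rewrite !homE; have [ju|ju] := ltP (l j u) 0.
    have := imin j ju; rewrite /f ler_pdivlMr ?oppr_gt0 //; lra.
  rewrite (le_trans (Dx j)) // lerDl mulr_ge0 //.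
  by rewrite divr_ge0 ?subr_ge0 ?oppr_ge0 //; first [exact: Dx|exact: ltW].
- rewrite !homE /f; field; by rewrite lt_eqF.
Qed.

(* Induction on the number of constraints that are inactive at [x]. *)
Lemma convex_hull_extreme x : polyhedron x -> convex_hull (extreme polyhedron) x.
Proof.
have [N] := ubnP #|[pred i | l i x != c i]|.
elim: N x => // N IH x /ltnSE xN Dx.
have [ex|] := pselect (extreme polyhedron x); first exact: convex_hull_gen.
move=> nex; have [u [u0 Du Dv]] : exists u, [/\ u != 0, polyhedron (x + u)
    & polyhedron (x - u)].
  apply: contrapT => H; apply: nex; split=> // u Du Dv.
  by apply/eqP/negP => /negP u0; apply: H; exists u.
(* Every exit point keeps the constraints active at [x] and gains one, so the induction hypothesis
   applies; [x] lies between the exit points along [u] and [- u]. *)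
have key v : v != 0 -> (forall i, l i x = c i -> l i v = 0) ->
    exists2 t, 0 < t & convex_hull (extreme polyhedron) (x + t *: v).
  move=> v0 hv; have [t [i [t0 Dt ix it]]] := exit_point Dx v0 hv.
  exists t => //; apply: IH => //; apply: leq_trans xN; apply: proper_card.
  apply/fintype.properP; split.
    apply/fintype.subsetP => j; rewrite !inE; apply: contraNneq => jx.
    by rewrite !homE jx hv // mulr0 addr0.
  by exists i; rewrite inE ?it ?eqxx.
have hu i : l i x = c i -> l i u = 0 by exact: active_dir.
have [t t0 Ht] := key u u0 hu.
have [|i ix|t' t'0 Ht'] := key (- u); first by rewrite oppr_eq0.
  by rewrite homN hu // oppr0.
have -> : x = (t' / (t + t')) *: (x + t *: u) +
    (1 - t' / (t + t')) *: (x + t' *: - u).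
  by apply: hom_ext => f; rewrite !homE; field; rewrite gt_eqF // addr_gt0.
have tt' : 0 < t + t' by rewrite addr_gt0.
apply: convex_convex_hull => //; first by rewrite divr_ge0 ?ltW.
by rewrite ler_pdivrMr // mul1r lerDr ltW.
Qed.

End Bounded.
End Polyhedra.

(** * Dual functionals of a lattice basis *)

Section RealDual.
Variables (R : realType) (V : vectType R).

(* The transition matrices between [b] and the lattice basis [e] are integral and
   mutually inverse, which bounds the length of [b] by the dimension. *)
Lemma Zbasis_dual (L : set V) (e : seq V) r (b : 'I_r -> V) :
  basis_of {:V} e -> L = Zspan [set` e] -> is_Zbasis L b ->
  r = \dim {:V} /\ exists d : 'I_r -> 'Hom(V, R^o),
    (forall i j, d i (b j) = (i == j)%:R) /\
    forall x, x = \sum_i (d i x : R) *: b i.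
Proof.
move=> be LE [LB indep]; pose E := in_tuple e; set n := size e in E.
have bE : basis_of {:V} E by [].
have freeE : free E by exact: basis_free be.
have nE : n = \dim {:V} by rewrite -(span_basis be); apply/esym/eqP; exact: freeE.
have Lb i : L (b i).
  by rewrite LB -[b i]scale1r; apply: lin_hull_gen; [exact: rpred1|exists i].
have Le (j : 'I_n) : L E`_j.
  rewrite LE -[_`_j]scale1r; apply: lin_hull_gen; first exact: rpred1.
  exact: mem_nth.
have int_coord x j : L x -> coord E j x \is a Num.int.
  rewrite LE; move: x; apply: lin_hull_min => /=; first by rewrite linear0 rpred0.
  move=> a v y aZ /= ve yZ; rewrite linearD linearZ /= rpredD // rpredM //.
  move: ve => /(nthP 0)[k kn <-].
  by rewrite (coord_free (Ordinal kn) j) // rpred_nat.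
have Zcomb x : L x -> exists z : 'I_r -> int, x = \sum_i (z i)%:~R *: b i.
  rewrite LB; move: x; apply: lin_hull_min.
    by exists (fun=> 0); rewrite big1 // => i _; rewrite scale0r.
  move=> _ _ y /= /intrP[a ->] [i _ <-] [z ->].
  exists (fun j => a *+ (j == i) + z j).
  under [RHS]eq_bigr do rewrite rmorphD /= scalerDl.
  rewrite big_split /=; congr (_ + _); rewrite (bigD1 i) //= eqxx big1 ?addr0 //.
  by move=> j /negPf ->; rewrite scale0r.
(* [M] gives the lattice basis in terms of [b], [N] gives [b] in terms of the lattice basis; both
   are integral. *)
have [M ME] := choice (fun j => Zcomb _ (Le j)).
pose N i j : int := Num.floor (coord E j (b i)).
have NE i : b i = \sum_j (N i j)%:~R *: E`_j.
  rewrite {1}(coord_basis bE (memvf (b i))); apply: eq_bigr => j _; congr (_ *: _).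
  by have := int_coord _ j (Lb i); rewrite intrEfloor => /eqP.
have NM : (\matrix_(i, j) N i j) *m (\matrix_(j, k) M j k) = 1%:M :> 'M[int]_r.
  apply/matrixP => i k; rewrite !mxE; under eq_bigr do rewrite !mxE.
  apply/eqP; rewrite -subr_eq0; apply/eqP.
  move: k; apply: (indep (fun k => \sum_j N i j * M j k - (i == k)%:R)).
  under eq_bigr do rewrite rmorphB rmorph_nat scalerBl.
  rewrite sumrB [X in _ - X](bigD1 i) //= eqxx scale1r [X in b i + X]big1; last first.
    by move=> j; rewrite eq_sym => /negPf ->; rewrite scale0r.
  rewrite addr0 [X in _ - X]NE; under [X in _ - X]eq_bigr do rewrite ME scaler_sumr.
  rewrite exchange_big /= -sumrB big1 // => k _; rewrite rmorph_sum scaler_suml -sumrB.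
  by rewrite big1 // => j _; rewrite scalerA rmorphM subrr.
(* The identity of size [r] factors through size [n], hence [r] is at most [n]. *)
have rn : (r <= \dim {:V})%N by rewrite -nE; exact: mulmx1_min NM.
pose B := [tuple b i | i < r].
have Bi (i : 'I_r) : B`_i = b i by rewrite -tnth_nth tnth_mktuple.
have bB : basis_of {:V} B.
  rewrite basisEdim size_tuple rn andbT -(span_basis be).
  apply/span_subvP => v /(nthP 0)[k kn <-].
  have := ME (Ordinal kn) => /= ->; apply: rpred_sum => i _; apply: rpredZ.
  by apply: memv_span; rewrite -Bi mem_nth // size_tuple.
have rV : r = \dim {:V}.
  rewrite -(span_basis bB) -[LHS](size_tuple B); apply/esym/eqP.
  exact: basis_free bB.
split=> //; exists (fun i => linfun (coord B i : V -> R^o)); split.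
  by move=> i j; rewrite lfunE /= -Bi coord_free ?(basis_free bB) // eq_sym.
move=> x; rewrite {1}(coord_basis bB (memvf x)).
by apply: eq_bigr => i _; rewrite Bi lfunE.
Qed.

End RealDual.

(** The coordinate functionals [d] are stored with the generators, so that membership in the cone
    and in the lattice is read from the sign and integrality of coordinates. For convex [D],
    [chart_in] yields a whole simplex of size [s] at [p]. *)
Record chart (R : realType) (V : vectType R) (L D : set V) (p : V) n
  (b : 'I_n -> V) (d : 'I_n -> 'Hom(V, R^o)) (s : R) : Prop := Chart {
  chart_gt0 : 0 < s;
  chart_dual : forall i j, d i (b j) = (i == j)%:R;
  chart_exp : forall x, x = \sum_i (d i x : R) *: b i;
  chart_lat : forall i, L (b i);
  chart_int : forall i y, L y -> (d i y : R) \is a Num.int;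
  chart_base : D p;
  chart_cone : forall y i, D y -> 0 <= d i (y - p);
  chart_in : forall i, D (p + s *: b i) }.

(** * Charts at a vertex: existence, simplices, edges *)

Section Charts.
Variables (R : realType) (V : vectType R) (L D : set V).
Hypothesis cD : convex_set D.

Lemma conic_hull_inner p x : D p -> conic_hull (translate D (- p)) x ->
  exists2 t : R, 0 < t & forall e, 0 < e -> e < t -> D (p + e *: x).
Proof.
move=> Dp; move: x; apply: lin_hull_min.
  by exists 1 => [|e _ _]; rewrite ?scaler0 ?addr0.
move=> a _ y a0 [z Dz <-] [t t0 ht] /=.
have a1 : 0 < a + 1 by rewrite ltr_wpDl.
exists (Num.min (t / 2) (2^-1 / (a + 1))).
  by rewrite lt_min !divr_gt0 // invr_gt0.
move=> e e0; rewrite lt_min => /andP[et]; rewrite ltr_pdivlMr // => ea.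
have -> : p + e *: (a *: (z - p) + y) =
    2^-1 *: ((2 * e * a) *: z + (1 - 2 * e * a) *: p) +
    (1 - 2^-1) *: (p + (2 * e) *: y).
  by apply: hom_ext => l; rewrite !homE; field.
have /= a0' : 0 <= a := a0.
apply: cD; [by lra|by lra| |by apply: ht; lra].
by apply: cD => //; nra.
Qed.

Lemma chart_exists (e : seq V) p r (b : 'I_r -> V) :
  basis_of {:V} e -> L = Zspan [set` e] -> dir D = setT -> D p ->
  is_Zbasis (L `&` dir D) b -> local_cone p D = conic_hull (range b) ->
  r = \dim {:V} /\ exists d s, chart L D p b d s.
Proof.
move=> be LE -> Dp; rewrite setIT => Zb coneE.
have [rV [d [dual expd]]] := Zbasis_dual be LE Zb; split=> //.
have inn i : exists2 t : R, 0 < t & forall e, 0 < e -> e < t -> D (p + e *: b i).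
  apply: conic_hull_inner => //; rewrite -/(local_cone p D) coneE -[b i]scale1r.
  by apply: lin_hull_gen; [exact: ler01|exists i].
have [t t0 ht] := small_all inn.
have dsum i (a : 'I_r -> R) : d i (\sum_j a j *: b j) = a i :> R.
  rewrite hom_sum (bigD1 i) //= homZ dual eqxx mulr1 big1 ?addr0 // => j ji.
  by rewrite homZ dual eq_sym (negPf ji) mulr0.
exists d, (t / 2); split=> //.
- by lra.
- move=> i; case: Zb => -> _; rewrite -[b i]scale1r.
  by apply: lin_hull_gen; [exact: rpred1|exists i].
- move=> i y; case: Zb => -> _; move: y; apply: lin_hull_min => /=.
    by rewrite hom0 rpred0.
  move=> a _ y aZ [j _ <-] yZ.
  by rewrite !homE dual rpredD // rpredM // rpred_nat.
- move=> y i Dy; have : local_cone p D (y - p).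
    rewrite -[y - p]scale1r; apply: lin_hull_gen; first exact: ler01.
    by exists y.
  rewrite coneE; move: (y - p); apply: (@lin_hull_min _ _ _ _ [set u | 0 <= d i u]) => /=.
    by rewrite hom0.
  move=> a _ u a0 [j _ <-] u0.
  by rewrite !homE dual addr_ge0 // mulr_ge0.
- by move=> i; apply: ht; lra.
Qed.

Section AtChart.
Variables (p : V) (n : nat) (b : 'I_n -> V) (d : 'I_n -> 'Hom(V, R^o)) (s : R).
Hypothesis ch : chart L D p b d s.
Implicit Types (x y u : V) (l : 'Hom(V, R^o)).

Lemma chart_hom l x : l x = \sum_i d i x * l (b i) :> R.
Proof.
rewrite {1}(chart_exp ch x) hom_sum.
by apply: eq_bigr => i _; rewrite homZ.
Qed.

Lemma chart_inj x y : (forall i, d i x = d i y :> R) -> x = y.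
Proof.
move=> h; rewrite (chart_exp ch x) (chart_exp ch y).
by apply: eq_bigr => i _; rewrite h.
Qed.

Lemma chart_simplex y : (forall i, 0 <= d i y) -> \sum_i (d i y : R) <= s ->
  D (p + y).
Proof.
move=> y0; set S := \sum_i _ => Ss.
have : 0 <= S by apply: sumr_ge0.
rewrite le_eqVlt => /predU1P[S0|S0].
  suff -> : y = 0 by rewrite addr0; exact: chart_base ch.
  apply: chart_inj => i; rewrite hom0.
  move/esym/eqP: S0; rewrite psumr_eq0 // => /allP/(_ i).
  by rewrite mem_index_enum => /(_ isT)/eqP.
have s0 := chart_gt0 ch.
have := @convex_sum _ _ D _ (index_enum 'I_n) xpredT (fun i => d i y : R)
  (fun i => p + s *: b i) cD (fun i _ => y0 i) (fun i _ _ => chart_in ch i) S0.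
rewrite -/S; under eq_bigr do rewrite scalerDr.
rewrite big_split /= -scaler_suml -/S.
under eq_bigr do rewrite scalerA mulrC -scalerA.
rewrite -scaler_sumr -(chart_exp ch) => Dz.
(* Rescale [y] to coordinate sum [s], reaching the far face of the simplex, then contract towards
   [p] by [S / s]. *)
have -> : p + y = (S / s) *: (S^-1 *: (S *: p + s *: y)) + (1 - S / s) *: p.
  by apply: hom_ext => l; rewrite !homE; field; rewrite !gt_eqF.
apply: cD => //; last exact: chart_base ch.
  by rewrite divr_ge0 ?ltW.
by rewrite ler_pdivrMr // mul1r.
Qed.

Lemma chart_segment i t : 0 <= t <= s -> D (p + t *: b i).
Proof.
move=> /andP[t0 ts]; apply: chart_simplex => [j|].
  by rewrite homZ (chart_dual ch) mulr_ge0.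
rewrite (bigD1 i) //= homZ (chart_dual ch) eqxx mulr1 big1 ?addr0 //.
by move=> j ji; rewrite homZ (chart_dual ch) (negPf ji) mulr0.
Qed.

Lemma chart_face_coord l y i : (forall z, D z -> l p <= l z) -> D y ->
  l y = l p -> l (b i) != 0 -> d i (y - p) = 0 :> R.
Proof.
move=> lD Dy ly li.
have lb j : 0 <= l (b j).
  have := lD _ (chart_in ch j); rewrite !homE lerDl.
  by rewrite pmulr_rge0 // (chart_gt0 ch).
have : \sum_j d j (y - p) * l (b j) == 0 by rewrite -chart_hom !homE ly subrr.
rewrite psumr_eq0 => [|j _]; last by rewrite mulr_ge0 // (chart_cone ch).
move=> /allP/(_ i); rewrite mem_index_enum => /(_ isT).
by rewrite mulf_eq0 (negPf li) orbF => /eqP.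
Qed.

(** The sum of the other coordinates attains its minimum over [D] at [p], and elsewhere only along
    the line of [b i]. *)
Lemma chart_edge i :
  let E := D `&` [set y | forall j, j != i -> d j y = d j p] in
  face D E /\ has_dim E 1.
Proof.
move=> E; have s0 := chart_gt0 ch.
have lE y : (\sum_(j | j != i) d j) y = \sum_(j | j != i) d j y by rewrite sum_lfunE.
have dle j y : D y -> d j p <= d j y.
  by move=> /(chart_cone ch j); rewrite !homE subr_ge0.
split.
  exists (\sum_(j | j != i) d j), (\sum_(j | j != i) d j p); split.
    by move=> y Dy; rewrite /= lE; apply: ler_sum => j _; exact: dle.
  apply/seteqP; split=> y [Dy hy]; split=> //; move: hy; rewrite /= lE.
    by move=> hy; apply: eq_bigr.
  move=> /eqP; rewrite -subr_eq0 -sumrB psumr_eq0 => [|j _]; last first.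
    by rewrite subr_ge0 dle.
  move=> /allP h j ji; apply/eqP; rewrite -subr_eq0.
  by have := h j; rewrite mem_index_enum ji => /(_ isT).
have Ep : E p by split=> //; exact: chart_base ch.
have bi0 : b i != 0.
  apply: contra_eq_neq (chart_dual ch i i) => ->.
  by rewrite hom0 eqxx eq_sym oner_eq0.
exists <[b i]>%VS; last by rewrite dim_vline bi0.
rewrite (dirE Ep); apply/seteqP; split => x.
  move: x; apply: lin_hull_min => /=; first exact: mem0v.
  move=> a _ y _ [z [Dz hz] <-] yE; apply: rpredD => //; apply: rpredZ.
  apply/vlineP; exists (d i (z - p)); apply: chart_inj => j.
  rewrite homZ (chart_dual ch); have [->|ji] := eqVneq j i; first by rewrite mulr1.
  by rewrite !homE hz // subrr mulr0.
move=> /= /vlineP[a ->].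
have -> : a *: b i = (a / s) *: (p + s *: b i - p).
  by apply: hom_ext => l; rewrite !homE; field; rewrite gt_eqF.
apply: lin_hull_gen => //; exists (p + s *: b i) => //.
split; first exact: (chart_in ch i).
by move=> j ji; rewrite !homE (chart_dual ch) (negPf ji) mulr0 addr0.
Qed.

(** The functional cutting out [E] vanishes on every generator that [x] involves, so such a
    generator lies in the direction of [E], which has dimension 1. *)
Lemma chart_edge_inv E x : edge D E -> E p -> E (p + x) -> x != 0 ->
  exists i (t : R), x = t *: b i.
Proof.
move=> [[l [c [Dl EE]]] [U dirE1 U1]] Ep Ex x0.
have [_ lp] : (D `&` [set y | l y = c]) p by rewrite -EE.
have [Dx lx] : (D `&` [set y | l y = c]) (p + x) by rewrite -EE.
have lD z : D z -> l p <= l z by rewrite lp; exact: Dl.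
have dx i : l (b i) != 0 -> d i x = 0 :> R.
  move=> li; have := chart_face_coord lD Dx _ li.
  by rewrite [p + x]addrC addrK; apply; rewrite [x + p]addrC lx.
have [i di] : exists i, d i x != 0 :> R.
  apply: contrapT => H; move/eqP: x0; apply; apply: chart_inj => i.
  by rewrite hom0; apply/eqP/negP => /negP di; apply: H; exists i.
have li : l (b i) = 0 by apply/eqP; apply: contraNT di => /dx ->.
exists i; have s0 := chart_gt0 ch.
have inU y : E (p + y) -> y \in U.
  move=> Ey; have : dir E y.
    exists p, (p + y); split; [exact: affine_hull_gen..|].
    by rewrite [p + y]addrC addrK.
  by rewrite dirE1.
have biU : b i \in U.
  have : s *: b i \in U.
    apply: inU; rewrite EE; split; first exact: (chart_in ch i).
    by rewrite /= !homE li mulr0 addr0.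
  by rewrite rpredZeq gt_eqF.
have bi0 : b i != 0.
  apply: contra_eq_neq (chart_dual ch i i) => ->.
  by rewrite hom0 eqxx eq_sym oner_eq0.
suff UE : <[b i]>%VS = U by apply/vlineP; rewrite UE; exact: inU.
by apply/eqP; rewrite eqEdim -memvE biU dim_vline bi0 U1.
Qed.

End AtChart.
End Charts.

(** * The hyperplane section read in a chart *)

Section HyperplaneSection.
Variables (R : realType) (V : vectType R) (L D : set V).
Hypotheses (cD : convex_set D) (LZ : Zspan L `<=` L).
Variables (p : V) (n : nat) (b : 'I_n -> V) (d : 'I_n -> 'Hom(V, R^o)) (s : R).
Hypothesis ch : chart L D p b d s.
Variables (h : 'Hom(V, R^o)) (k : 'I_n -> bool).
Hypothesis hb : forall i, h (b i) = (k i)%:R.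
Variable e : R.
Hypothesis e_gt0 : 0 < e.

Let P : set V := D `&` [set y | h y = h p + e].

(* As [x] is strictly between the chart point [p]
   and [q], it can be moved in [D] along every generator that it involves. *)
Lemma chart_wiggle x q a i : 0 < a <= 1 -> D q -> x = a *: p + (1 - a) *: q ->
  0 < d i (x - p) ->
  exists2 t : R, 0 < t & forall m, 0 < m -> m < t ->
    D (x + m *: b i) /\ D (x - m *: b i).
Proof.
move=> /andP[a0 a1] Dq xE xi.
have xp : x - p = (1 - a) *: (q - p).
  by apply: hom_ext => l; rewrite xE !homE; ring.
have {}a1 : a < 1.
  rewrite lt_neqAle a1 andbT; apply: contraTneq xi => a1'.
  by rewrite xp a1' subrr scale0r hom0 ltxx.
have s0 := chart_gt0 ch.
set S := \sum_j (d j (q - p) : R).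
have q0 j : 0 <= d j (q - p) := chart_cone ch j Dq.
have S0 : 0 <= S by apply: sumr_ge0.
have S1 : 0 < S + 1 by rewrite ltr_wpDl.
(* To subtract along [b i], shift weight [dl] from [q] to the chart point: the first bound keeps
   weight on [q], the second keeps the displaced chart point inside the simplex of size [s]. *)
pose dl := Num.min ((1 - a) / 2) (s * a / (S + 1)).
have dl0 : 0 < dl by rewrite lt_min !divr_gt0 ?subr_gt0 // mulr_gt0.
have dla : dl < 1 - a by rewrite gt_min; apply/orP; left; lra.
have dlS : dl * (S + 1) <= s * a by rewrite -ler_pdivlMr // ge_min lexx orbT.
have qi : 0 < d i (q - p) by move: xi; rewrite xp homZ pmulr_rgt0 ?subr_gt0.
exists (Num.min (a * s) (dl * d i (q - p))); first by rewrite lt_min !mulr_gt0.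
move=> m m0; rewrite lt_min => /andP[mas mdl].
split.
  have -> : x + m *: b i = a *: (p + (m / a) *: b i) + (1 - a) *: q.
    by apply: hom_ext => l; rewrite xE !homE; field; rewrite gt_eqF.
  apply: cD => //; [exact: ltW|exact: ltW|].
  apply: (chart_segment cD ch); apply/andP; split; first by rewrite divr_ge0 ?ltW.
  by rewrite ler_pdivrMr // mulrC ltW.
have ad : 0 < a + dl by rewrite addr_gt0.
pose r := (a + dl)^-1 *: (dl *: (q - p) - m *: b i).
have -> : x - m *: b i = (a + dl) *: (p + r) + (1 - (a + dl)) *: q.
  by apply: hom_ext => l; rewrite xE !homE; field; rewrite gt_eqF.
have rE j : d j r = (a + dl)^-1 * (dl * d j (q - p) - m * (j == i)%:R) :> R.
  by rewrite !homE (chart_dual ch).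
apply: cD => //; [by lra|by lra|].
apply: (chart_simplex cD ch) => [j|].
  rewrite rE; apply: mulr_ge0; first by rewrite invr_ge0 ltW.
  rewrite subr_ge0.
  have [->|_] := eqVneq j i; first by rewrite mulr1 ltW.
  by rewrite mulr0; apply: mulr_ge0 => //; exact: ltW.
under eq_bigr do rewrite rE.
rewrite -mulr_sumr mulrC ler_pdivrMr // sumrB -mulr_sumr -/S.
have : 0 <= \sum_j m * (j == i)%:R.
  by apply: sumr_ge0 => j _; apply: mulr_ge0 => //; exact: ltW.
nra.
Qed.

(** A generator of level 0 moves [x] inside the section, and two generators of level 1 can be traded
    against each other; extremality excludes both. The level of the section then fixes the remaining
    coefficient as [e]. *)
Lemma extreme_section x q a : extreme P x -> 0 < a <= 1 -> D q ->
  x = a *: p + (1 - a) *: q -> exists2 i, k i & x = p + e *: b i.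
Proof.
move=> [[Dx hx] ex] a01 Dq xE.
have wiggle i := chart_wiggle a01 Dq xE (i := i).
have ki i : 0 < d i (x - p) -> k i.
  move=> di; apply/negP => /negP nki; have [t t0 ht] := wiggle i di.
  have [||D1 D2] := ht (t / 2); [by lra..|].
  have hi : h ((t / 2) *: b i) = 0 by rewrite homZ hb (negPf nki) mulr0.
  have : (t / 2) *: b i = 0.
    by apply: ex; split=> //=; rewrite homD ?homN hi ?oppr0 addr0.
  move/(congr1 (d i)); rewrite homZ (chart_dual ch) eqxx hom0 mulr1; lra.
have uniq_i i j : 0 < d i (x - p) -> 0 < d j (x - p) -> i = j.
  move=> di dj; apply/eqP/negP => /negP ij.
  have [t t0 ht] := wiggle i di; have [t' t'0 ht'] := wiggle j dj.
  have tt : 0 < Num.min t t' by rewrite lt_min t0.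
  pose m := Num.min t t' / 2.
  have m0 : 0 < m by rewrite /m; lra.
  have mt : m < t /\ m < t'.
    by apply/andP; rewrite -lt_min /m; lra.
  have [D1 D2] := ht m m0 mt.1; have [D3 D4] := ht' m m0 mt.2.
  pose u := (m / 2) *: (b i - b j).
  have hu : h u = 0 by rewrite !homE !hb (ki i di) (ki j dj) subrr mulr0.
  have : u = 0.
    apply: ex; split; rewrite /= ?homD ?homN ?hu ?oppr0 ?addr0 //.
      have -> : x + u = 2^-1 *: (x + m *: b i) + (1 - 2^-1) *: (x - m *: b j).
        by apply: hom_ext => l; rewrite !homE; field.
      by apply: cD => //; lra.
    have -> : x - u = 2^-1 *: (x - m *: b i) + (1 - 2^-1) *: (x + m *: b j).
      by apply: hom_ext => l; rewrite !homE; field.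
    by apply: cD => //; lra.
  move/(congr1 (d i)); rewrite /u !homE !(chart_dual ch) eqxx (negPf ij) /=.
  by rewrite subr0 mulr1; lra.
have di0 i : 0 <= d i (x - p) := chart_cone ch i Dx.
have [i di] : exists i, 0 < d i (x - p).
  apply: contrapT => H; suff xp : x = p.
    by move/eqP: hx; rewrite /= xp -[X in X == _]addr0 (inj_eq (addrI _)) lt_eqF.
  apply: (chart_inj ch) => i; apply/eqP; rewrite -subr_eq0 -homN -homD eq_le di0.
  by rewrite andbT leNgt; apply/negP => di; apply: H; exists i.
have xpE : x - p = (d i (x - p) : R) *: b i.
  apply: (chart_inj ch) => j; rewrite homZ (chart_dual ch).
  have [->|ji] := eqVneq j i; first by rewrite mulr1.
  rewrite mulr0; apply/eqP; rewrite eq_le di0 andbT leNgt.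
  by apply: contraNN ji => dj; apply/eqP; exact: uniq_i.
exists i; first exact: ki.
have -> : e = d i (x - p).
  have : h (x - p) = d i (x - p) :> R.
    by rewrite xpE !homE hb ki // mulr1 (chart_dual ch) eqxx mulr1.
  by rewrite homD homN hx addrC addKr.
by rewrite -xpE addrC subrK.
Qed.

Section Vertex.
Variable i0 : 'I_n.
Hypotheses (ki0 : k i0) (es : e < s).

Let x := p + e *: b i0.
(** A generator of level 1 is bent towards the section point on its own edge; one of level 0 is left
    unchanged. [lift i0] drops the generator through [x]. *)
Let b' (j : 'I_n.-1) := b (lift i0 j) - (k (lift i0 j))%:R *: b i0.

Lemma section_generator_level j : h (b' j) = 0.
Proof. by rewrite /b' !homE !hb ki0 mulr1 subrr. Qed.

Lemma section_generator_dual i j : d (lift i0 i) (b' j) = (i == j)%:R :> R.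
Proof.
rewrite /b' !homE !(chart_dual ch) eq_sym [_ == i0]eq_sym (negPf (neq_lift _ _)).
by rewrite mulr0 subr0 (inj_eq (@lift_inj _ i0)) eq_sym.
Qed.

Lemma section_exp u : h u = 0 -> u = \sum_j (d (lift i0 j) u : R) *: b' j.
Proof.
move=> hu; under eq_bigr do rewrite scalerBr scalerA -mulr_natr.
rewrite sumrB -scaler_suml; set S := \sum_i _.
have hE := chart_hom ch h u.
rewrite (bigD1_ord i0) //= hb ki0 mulr1 hu in hE.
have -> : S = - d i0 u.
  apply/eqP; rewrite -addr_eq0 addrC; apply/eqP; rewrite [RHS]hE; congr (_ + _).
  by apply: eq_bigr => j _; rewrite hb mulr_natr.
by rewrite {1}(chart_exp ch u) (bigD1_ord i0) //= addrC scaleNr opprK.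
Qed.

Lemma section_lattice j : L (b' j).
Proof.
apply: LZ; apply: lin_hullD.
  by rewrite -[b _]scale1r; apply: lin_hull_gen; [exact: rpred1|exact: (chart_lat ch)].
rewrite -scaleNr; apply: lin_hull_gen; last exact: (chart_lat ch).
by rewrite /= rpredN rpred_nat.
Qed.

Lemma section_mem : P x.
Proof.
split; last by rewrite /= !homE hb ki0 mulr1.
by apply: (chart_segment cD ch); rewrite !ltW.
Qed.

Lemma section_inner : exists2 t : R, 0 < t & forall j, P (x + t *: b' j).
Proof.
(* [t <= e] keeps the coordinate along [b i0] nonnegative, [t <= s - e] keeps the coordinate sum at
   most [s]. *)
have [t [t0 te ts]] : exists t : R, [/\ 0 < t, t <= e & t <= s - e].
  exists (Num.min e (s - e)).
  by rewrite lt_min e_gt0 subr_gt0 es !ge_min !lexx orbT.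
exists t => // j; have [_ hx] := section_mem; split; last first.
  by rewrite /= homD homZ section_generator_level mulr0 addr0.
pose j' := lift i0 j; have jj : j' != i0 by rewrite eq_sym neq_lift.
have -> : x + t *: b' j = p + ((e - t * (k j')%:R) *: b i0 + t *: b j').
  by apply: hom_ext => l; rewrite /x /b' !homE -/j'; ring.
have ek : 0 <= e - t * (k j')%:R.
  by case: (k j') => /=; rewrite ?mulr1 ?mulr0; have := e_gt0; lra.
apply: (chart_simplex cD ch) => [i|].
  by rewrite !homE !(chart_dual ch) addr_ge0 // mulr_ge0 // ltW.
under eq_bigr do rewrite !homE !(chart_dual ch).
rewrite big_split /= (bigD1 i0) //= [X in _ + X + _]big1 => [|i /negPf ->]; last first.
  by rewrite mulr0.
rewrite (bigD1 j') //= [X in _ + (_ + X)]big1 => [|i /negPf ->]; last first.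
  by rewrite mulr0.
by rewrite !eqxx; case: (k j') ek => /=; lra.
Qed.

Lemma section_cone y j : P y -> 0 <= d (lift i0 j) (y - x).
Proof.
move=> [Dy _]; have := chart_cone ch (lift i0 j) Dy.
rewrite /x !homE (chart_dual ch) [_ == i0]eq_sym (negPf (neq_lift _ _)).
by rewrite mulr0 addr0.
Qed.

Lemma section_level y : P y -> h (y - x) = 0.
Proof. by have [_ hx] := section_mem; move=> [_ hy]; rewrite homD homN hx hy subrr. Qed.

(** The sum of the coordinates other than [i0] is minimal on the section at [x] alone, since these
    coordinates determine a vector of level 0. *)
Lemma section_vertex : vertex P x.
Proof.
pose l := \sum_j d (lift i0 j).
have lE y : l y = \sum_j d (lift i0 j) y by rewrite /l sum_lfunE.
have ly y : P y -> 0 <= l (y - x).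
  by move=> Py; rewrite lE; apply: sumr_ge0 => j _; exact: section_cone.
exists l, (l x); split.
  by move=> y /ly; rewrite homD homN subr_ge0.
apply/seteqP; split=> [_ ->|y [Py lyx]]; first by split=> //; exact: section_mem.
apply/eqP; rewrite -subr_eq0 (section_exp (section_level Py)) big1 // => j _.
have : l (y - x) == 0 by rewrite homD homN lyx subrr.
rewrite lE psumr_eq0 => [/allP/(_ j)|i _]; last exact: section_cone.
by rewrite mem_index_enum => /(_ isT)/eqP ->; rewrite scale0r.
Qed.

Lemma section_dir : dir P = [set` lker h].
Proof.
rewrite (dirE section_mem); apply/seteqP; split=> u.
  move: u; apply: lin_hull_min => /=; first exact: mem0v.
  move=> a _ y _ [z Pz <-] hy; apply: rpredD => //; apply: rpredZ.
  by rewrite memv_ker section_level.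
rewrite /= memv_ker => /eqP/section_exp ->; apply: lin_hull_sum => j _.
have [t t0 ht] := section_inner.
have -> : b' j = t^-1 *: (x + t *: b' j - x).
  by rewrite addrC addKr scalerA mulVf ?scale1r ?gt_eqF.
rewrite scalerA; apply: lin_hull_gen => //.
by exists (x + t *: b' j).
Qed.

Lemma section_Zbasis : is_Zbasis (L `&` dir P) b'.
Proof.
split.
  rewrite section_dir; apply/seteqP; split=> u.
    move=> [Lu]; rewrite /= memv_ker => /eqP/section_exp ->.
    apply: lin_hull_sum => j _; apply: lin_hull_gen; last by exists j.
    exact: (chart_int ch).
  move=> Hu; split.
    apply: LZ; apply: lin_hull_trans Hu => [a a' /= aZ a'Z|_ [j _ <-]].
      exact: rpredM.
    rewrite -[b' j]scale1r; apply: lin_hull_gen; first exact: rpred1.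
    exact: section_lattice.
  move: u Hu; apply: lin_hull_min => /=; first exact: mem0v.
  move=> a _ y _ [j _ <-] hy; apply: rpredD => //; apply: rpredZ.
  by rewrite memv_ker section_generator_level.
move=> z /(congr1 (fun u => d (lift i0 _) u)) + i => /(_ i).
rewrite hom0 hom_sum (bigD1 i) //= homZ section_generator_dual eqxx mulr1.
rewrite big1 ?addr0 => [/eqP|j ji]; first by rewrite intr_eq0 => /eqP.
by rewrite homZ section_generator_dual eq_sym (negPf ji) mulr0.
Qed.

Lemma section_local_cone : local_cone x P = conic_hull (range b').
Proof.
have mul0 (a a' : R) : [set a : R | 0 <= a] a -> [set a : R | 0 <= a] a' ->
  [set a : R | 0 <= a] (a * a') by exact: mulr_ge0.
apply/seteqP; split; apply: (lin_hull_trans mul0) => z.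
  move=> [y Py <-]; rewrite (section_exp (section_level Py)).
  apply: lin_hull_sum => j _; apply: lin_hull_gen; first exact: section_cone.
  by exists j.
move=> [j _ <-]; have [t t0 ht] := section_inner.
have -> : b' j = t^-1 *: (x + t *: b' j - x).
  by rewrite addrC addKr scalerA mulVf ?scale1r ?gt_eqF.
apply: lin_hull_gen; first by rewrite /= invr_ge0 ltW.
by exists (x + t *: b' j).
Qed.

Lemma section_rational : [set` lker h] = Rspan ([set` lker h] `&` L).
Proof.
apply/seteqP; split=> u.
  rewrite /= memv_ker => /eqP/section_exp ->; apply: lin_hull_sum => j _.
  apply: lin_hull_gen => //; split; last exact: section_lattice.
  by rewrite /= memv_ker section_generator_level.
move: u; apply: lin_hull_min => /=; first exact: mem0v.
by move=> a v y _ [/= hv _] hy; rewrite rpredD // rpredZ.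
Qed.

End Vertex.
End HyperplaneSection.

(** * The weight lattice and rational polyhedra in the dual space *)

Section DualSpace.
Variables (R : realType) (g : vectType R).

Definition pairing (v : g) (x : dual_space g) : R^o := x v.

Fact pairing_is_linear v : linear (pairing v).
Proof. by move=> a x y; rewrite /pairing add_lfunE scale_lfunE. Qed.

HB.instance Definition _ v := GRing.isLinear.Build R (dual_space g) R^o _
  (pairing v) (pairing_is_linear v).

Definition eval_at (v : g) : 'Hom(dual_space g, R^o) := linfun (pairing v).

Lemma eval_atE v (x : dual_space g) : eval_at v x = x v.
Proof. by rewrite lfunE. Qed.

Lemma dim_dual : \dim {:dual_space g} = \dim {:g}.
Proof. by rewrite !dimvf /= /dim /= muln1. Qed.

Variables (G : zmodType) (expG : {additive g -> G}).
Let L := weight_lattice expG.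

(** The functionals dual to a basis of the integral lattice serve: a weight is integral on that
    basis, so its coordinates are integers. *)
Lemma weight_lattice_basis : torus_exp expG ->
  exists2 e : seq (dual_space g), basis_of {:dual_space g} e & L = Zspan [set` e].
Proof.
move=> [_ [b bb bE]].
pose f i : dual_space g := linfun (coord b i : g -> R^o).
have fE i x : f i x = coord b i x by rewrite lfunE.
have expand (x : dual_space g) : x = \sum_(i < \dim {:g}) (x b`_i : R) *: f i.
  apply/lfunP => v; rewrite sum_lfunE {1}(coord_basis bb (memvf v)) hom_sum.
  by apply: eq_bigr => i _; rewrite homZ scale_lfunE fE mulrC.
exists [seq f i | i <- enum 'I_(\dim {:g})].
  rewrite basisEdim size_map size_enum_ord dim_dual leqnn andbT.
  apply/subvP => x _; rewrite [x]expand; apply: rpred_sum => i _; apply: rpredZ.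
  by apply: memv_span; apply: map_f; rewrite mem_enum.
apply/seteqP; split=> x.
  move=> Lx; rewrite [x]expand; apply: lin_hull_sum => i _; apply: lin_hull_gen.
    apply: Lx; have -> : int_lattice expG = Zspan [set` b] by [].
    rewrite -[b`_i]scale1r; apply: lin_hull_gen; first exact: rpred1.
    by apply: mem_nth; rewrite size_tuple.
  by apply: map_f; rewrite mem_enum.
move: x; apply: lin_hull_min; first by move=> v _; rewrite lfunE rpred0.
move=> a _ y aZ /mapP[i _ ->] Ly v Lv; rewrite add_lfunE scale_lfunE rpredD ?Ly //.
rewrite rpredM // fE; move: Lv; have -> : int_lattice expG = Zspan [set` b] by [].
move: v; apply: lin_hull_min => /=; first by rewrite linear0 rpred0.
move=> c v z cZ /(nthP 0)[k] kb <- zZ.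
rewrite linearD linearZ /= rpredD // rpredM //.
rewrite size_tuple in kb.
by rewrite (coord_free (Ordinal kb)) ?(basis_free bb) // rpred_nat.
Qed.

Lemma Zspan_weight_lattice : Zspan L `<=` L.
Proof.
apply: lin_hull_min; first by move=> v _; rewrite lfunE rpred0.
move=> a x y aZ Lx Ly v Lv; rewrite add_lfunE scale_lfunE rpredD ?Ly //.
by rewrite rpredM // Lx.
Qed.

Lemma rational_setI (D E : set (dual_space g)) :
  Defs.rational expG D -> Defs.rational expG E -> Defs.rational expG (D `&` E).
Proof.
move=> [m [v [c [vL ->]]]] [p [u [d [uL ->]]]].
exists (m + p)%N,
  (fun i : 'I_(m + p) =>
     match fintype.split i with inl i => v i | inr i => u i end),
  (fun i : 'I_(m + p) =>
     match fintype.split i with inl i => c i | inr i => d i end).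
split; first by move=> i; case: (fintype.split i).
apply/seteqP; split=> x /=.
  by move=> [hx hy] i; case: (fintype.split i).
move=> h; split=> i.
  by have := h (lshift p i); rewrite (unsplitK (inl i : 'I_m + 'I_p)).
by have := h (rshift m i); rewrite (unsplitK (inr i : 'I_m + 'I_p)).
Qed.

Lemma rational_hyperplane v (c : R) : int_lattice expG v ->
  Defs.rational expG [set x : dual_space g | x v = c].
Proof.
move=> Lv; have -> : [set x : dual_space g | x v = c] =
    [set x : dual_space g | forall i : 'I_1, c <= x v] `&`
    [set x : dual_space g | forall i : 'I_1, - c <= x (- v)].
  apply/seteqP; split=> x /=; first by move=> xv; split=> _; rewrite ?homN xv.
  move=> [/(_ 0) h1 /(_ 0)]; rewrite homN lerN2 => h2.
  by apply/eqP; rewrite eq_le h1 h2.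
apply: rational_setI; first by exists 1%N, (fun=> v), (fun=> c).
exists 1%N, (fun=> - v), (fun=> - c); split=> // _.
by move: Lv; rewrite /int_lattice /= raddfN => ->; rewrite oppr0.
Qed.

Lemma rational_polyhedron (D : set (dual_space g)) : Defs.rational expG D ->
  exists M (l : 'I_M -> 'Hom(dual_space g, R^o)) c, D = polyhedron l c.
Proof.
move=> [M [v [c [_ ->]]]]; exists M, (fun i => eval_at (v i)), c.
by apply/seteqP; split=> x h i; have := h i; rewrite /= eval_atE.
Qed.

End DualSpace.

(** * Primitive vectors and the edges leaving a face *)

Lemma primitive_dual_one (R : realType) (V : vectType R) (L : set V)
    (f : V -> R) x :
  (forall y n, f (y *+ n) = f y *+ n) -> (forall y, L y -> f y \is a Num.int) ->
  L x -> f x = 1 -> primitive L x.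
Proof.
move=> fM fL Lx fx; split=> //.
  apply/eqP => x0; move: fx; rewrite x0 -(mulr0n x) fM mulr0n => /eqP.
  by rewrite eq_sym oner_eq0.
move=> k y k2 Ly xE; move: fx; rewrite xE fM.
(* From [x = y *+ k] the value 1 of [f] becomes [k] times an integer, impossible for [k] at least
   2. *)
have /intrP[z ->] := fL y Ly.
rewrite -mulr_natr (pmulrn 1 k) -intrM -[RHS]/(1%:~R) => /eqP.
rewrite eqr_int => /eqP/(congr1 absz); rewrite abszM absz_nat => /eqP.
by rewrite muln_eq1 => /andP[_ /eqP k1]; rewrite k1 in k2.
Qed.

Lemma chart_primitive (R : realType) (V : vectType R) (L D : set V) p n
    (b : 'I_n -> V) (d : 'I_n -> 'Hom(V, R^o)) s i :
  chart L D p b d s -> primitive L (b i).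
Proof.
move=> ch; apply: (@primitive_dual_one _ _ _ (d i)).
- by move=> y m; rewrite raddfMn.
- by move=> y; exact: (chart_int ch).
- exact: (chart_lat ch).
- by rewrite (chart_dual ch) eqxx.
Qed.

(** The flag [k i] records whether the functional [l] defining [F] is nonzero on [b i]. If it is,
    the edge along [b i] leaves [F] and [b i] is some [beta j], of level 1; if not, that edge lies
    in [F], where [h] is constant, so [b i] has level 0. The last clause follows because
    [h x <= h p] kills all coordinates flagged by [k]. *)
Lemma face_chart (R : realType) (V : vectType R) (L D F : set V) r
    (h : 'Hom(V, R^o)) (beta : 'I_r -> V) p n (b : 'I_n -> V)
    (d : 'I_n -> 'Hom(V, R^o)) s :
  chart L D p b d s -> face D F -> F p -> (forall x, F x -> h x = h p) ->
  [set v | exists2 E, edge_vector L D p E v & ~ (E `<=` F)] = range beta ->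
  (forall i, h (beta i) = 1) ->
  exists k : 'I_n -> bool,
    [/\ forall i, h (b i) = (k i)%:R,
        forall i, k i -> exists j, b i = beta j,
        forall j, exists2 i, k i & beta j = b i &
        forall x, D x -> h x <= h p -> F x].
Proof.
move=> ch [l [c [Dl FE]]] Fp hF betaE hbeta; have s0 := chart_gt0 ch.
have [Dp lp] : (D `&` [set y | l y = c]) p by rewrite -FE.
have lD z : D z -> l p <= l z by rewrite lp; exact: Dl.
have lb i : 0 <= l (b i).
  have := lD _ (chart_in ch i); rewrite !homE lerDl.
  by rewrite pmulr_rge0.
pose k i := l (b i) != 0.
have kbeta i : k i -> exists j, b i = beta j.
  move=> ki; suff : range beta (b i) by move=> [j _ <-]; exists j.
  rewrite -betaE; exists (D `&` [set y | forall j, j != i -> d j y = d j p]).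
    have [Ef E1] := chart_edge ch i; split=> //.
    - exact: chart_primitive ch.
    - exists s => //; split; first exact: (chart_in ch).
      by move=> j ji; rewrite !homE (chart_dual ch) (negPf ji) mulr0 addr0.
  move=> EF; have : F (p + s *: b i).
    apply: EF; split; first exact: (chart_in ch).
    by move=> j ji; rewrite !homE (chart_dual ch) (negPf ji) mulr0 addr0.
  rewrite FE => -[_] /=; rewrite !homE lp => /eqP.
  by rewrite -[X in _ == X]addr0 (inj_eq (addrI _)) mulf_eq0 gt_eqF //= (negPf ki).
have hb i : h (b i) = (k i)%:R.
  have [ki|/negbNE/eqP li] := boolP (k i).
    by have [j ->] := kbeta i ki; rewrite hbeta.
  have : h (p + s *: b i) = h p.
    apply: hF; rewrite FE; split; first exact: (chart_in ch).
    by rewrite /= !homE li mulr0 addr0.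
  rewrite !homE => /eqP; rewrite -[X in _ == X]addr0 (inj_eq (addrI _)).
  by rewrite mulf_eq0 gt_eqF //= => /eqP.
exists k; split=> //.
- move=> j; have : range beta (beta j) by exists j.
  rewrite -betaE => -[E [Ee Ep _ [t t0 Et]] _].
  have bj0 : beta j != 0.
    by apply: contra_eq_neq (hbeta j) => ->; rewrite hom0 eq_sym oner_neq0.
  have [|i [u uE]] := chart_edge_inv ch Ee Ep Et.
    by rewrite scaler_eq0 gt_eqF.
  (* [h] takes the values [t] and [u * k i] on this vector; as [t] is positive, [k i] holds and
     [t = u]. *)
  have tu : t = u * (k i)%:R.
    by have /(congr1 h) := uE; rewrite !homZ hbeta hb mulr1.
  have ki : k i by apply: contraTT t0 => /negPf ki; rewrite tu ki mulr0 ltxx.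
  exists i => //; rewrite ki mulr1 in tu; rewrite tu in uE t0.
  by apply: (scalerI _ uE); rewrite gt_eqF.
- move=> x Dx hx.
  have dk i : 0 <= d i (x - p) * (k i)%:R by rewrite mulr_ge0 ?(chart_cone ch).
  have : \sum_i d i (x - p) * (k i)%:R == 0.
    rewrite eq_le sumr_ge0 // andbT.
    have := chart_hom ch h (x - p); under eq_bigr do rewrite hb.
    by move=> <-; rewrite !homE subr_le0.
  rewrite psumr_eq0 // => /allP d0; rewrite FE; split=> //.
  suff : l (x - p) = 0 by rewrite /= !homE lp => /subr0_eq.
  rewrite (chart_hom ch) big1 // => i _.
  have := d0 i; rewrite mem_index_enum => /(_ isT).
  rewrite mulf_eq0 pnatr_eq0 eqb0 negbK => /orP[]/eqP ->; first by rewrite mul0r.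
  by rewrite mulr0.
Qed.

(** * From charts at the vertices of the face to the global section *)

Theorem proposition5p3 (R : realType) (n k m : nat)
    (g : vectType R) (G : zmodType) (expG : {additive g -> G})
    (Delta F : set (dual_space g))
    (xi : 'I_m -> dual_space g)
    (Fc : 'I_(n - k) -> set (dual_space g))
    (w : 'I_(n - k) -> g) (c : 'I_(n - k) -> R)
    (beta : 'I_m -> 'I_(n - k) -> dual_space g)
    (dim_g : \dim {:g} = n)
    (torusG : torus_exp expG)
    (dim_Delta : has_dim Delta n)
    (unimod_Delta : unimodular expG Delta)
    (le_k_n2 : (k + 2 <= n)%N)
    (F_face : face Delta F)
    (F_neq0 : F !=set0)
    (dim_F : has_dim F k)
    (xi_inj : injective xi)
    (xi_vertices : [set x | vertex F x] = range xi)
    (Fc_inj : injective Fc)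
    (Fc_facets : [set H | facet Delta H /\ F `<=` H] = range Fc)
    (w_conormal : forall i, inward_conormal expG Delta (Fc i) (w i) (c i))
    (beta_edges : forall j,
       [set b | exists2 E, edge_vector (weight_lattice expG) Delta (xi j) E b
                           & ~ (E `<=` F)] = range (beta j))
    (beta_dual : forall j i r, beta j i (w r) = (i == r)%:R) :
  let wF := \sum_i w i in
  let cF := \sum_i c i in
  let A (e : R) : set (dual_space g) := [set x : dual_space g | x wF = cF + e] in
  let V (e : R) : set (dual_space g) :=
    [set x | exists j i, x = xi j + e *: beta j i] in
  [/\ primitive (int_lattice expG) wF,
      forall e : R, 0 < e -> V e `<=` A e &
      exists2 e0 : R, 0 < e0 & forall e : R, 0 < e -> e < e0 ->
        [/\ integrally_transverse expG (A e) Delta,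
            unimodular expG (A e `&` Delta) &
            [set x | vertex (A e `&` Delta) x] = V e]].
Proof.
move=> wF cF A V.
set L := weight_lattice expG in beta_edges *.
have LZ : Zspan L `<=` L := @Zspan_weight_lattice _ _ _ expG.
have [eL eLb LE] := weight_lattice_basis torusG.
have dirT : dir Delta = setT.
  have [U -> dimU] := dim_Delta; apply/seteqP; split=> // x _ /=.
  suff -> : U = fullv by exact: memvf.
  by apply/eqP; rewrite eqEdim subvf dim_dual dim_g dimU leqnn.
have [[S DS] ratD uniD] := unimod_Delta.
have [M [lD [cD Dpoly]]] := rational_polyhedron ratD.
have cvxD : convex_set Delta by rewrite DS; exact: convex_convex_hull.
have sub_hull B : B `<=` Delta -> convex_hull B `<=` Delta by exact: convex_hull_min.
have FD : F `<=` Delta by case: F_face => l [? [_ ->]] x [].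
have extV x : extreme Delta x -> vertex Delta x.
  by rewrite Dpoly; exact: extreme_vertex.
(* Minkowski's theorem for [Delta]: rationality provides the inequalities, the finite hull the
   boundedness. *)
have DV x : Delta x -> convex_hull (extreme Delta) x.
  rewrite {1}Dpoly => Dx; rewrite Dpoly.
  by apply: (@convex_hull_extreme _ _ _ _ _ S) => //; rewrite -Dpoly -DS.
have VF x : vertex Delta x -> F x -> exists j, x = xi j.
  move=> [l [a [Dl xE]]] Fx.
  suff : range xi x by move=> [j _ <-]; exists j.
  rewrite -xi_vertices; exists l, a; split; first by move=> y /FD/Dl.
  have [_ lx] : (Delta `&` [set y | l y = a]) x by rewrite -xE.
  apply/seteqP; split=> [_ ->|y [/FD Dy ly]]; first by [].
  by rewrite xE.
have Fxi j : F (xi j).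
  have : [set x | vertex F x] (xi j) by rewrite xi_vertices; exists j.
  by move=> [l [a [_ xE]]]; have [] : (F `&` [set y | l y = a]) (xi j) by rewrite -xE.
have Vxi j : vertex Delta (xi j).
  have : [set x | vertex F x] (xi j) by rewrite xi_vertices; exists j.
  by move=> /vertex_extreme /(extreme_face F_face (Fxi j)); exact: extV.
(* A vertex of [F] exists: splitting a point of [F] along the functional defining [F] yields a
   vertex of [Delta] at its minimal level. *)
have [j0 _] : exists j0 : 'I_m, True.
  have [l [a [Dl FE]]] := F_face; have [f Ff] := F_neq0.
  have [p [q [t [_ /extV Vp _ lp _]]]] := convex_hull_split l (DV f (FD _ Ff)).
  have [_ lf] : (Delta `&` [set y | l y = a]) f by rewrite -FE.
  have Dp : Delta p by have [] := vertex_extreme Vp.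
  have [|j _] := VF p Vp; last by exists j.
  by rewrite FE; split=> //; apply/eqP; rewrite eq_le /= -{1}lf lp; exact: Dl.
have i0 : 'I_(n - k).
  apply: (Ordinal (n := n - k) (m := 0)).
  by rewrite subn_gt0 (leq_trans _ le_k_n2) // addn2 ltnS leqnSn.
pose h := eval_at wF.
have hE (x : dual_space g) : h x = x wF by rewrite /h eval_atE.
have hsum (x : dual_space g) : h x = \sum_i (x (w i) : R) by rewrite hE linear_sum.
have hF x : F x -> h x = cF.
  move=> Fx; rewrite hsum; apply: eq_bigr => i _.
  have [_ _ FcE] := w_conormal i.
  have : [set H | facet Delta H /\ F `<=` H] (Fc i) by rewrite Fc_facets; exists i.
  by move=> [_ /(_ x Fx)]; rewrite FcE => -[].
have hbeta j i : h (beta j i) = 1.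
  rewrite hsum (bigD1 i) //= beta_dual eqxx big1 ?addr0 // => r ri.
  by rewrite beta_dual eq_sym (negPf ri).
have Lw i : int_lattice expG (w i) by have [[]] := w_conormal i.
have LwF : int_lattice expG wF.
  rewrite /int_lattice /= /wF raddf_sum big1 // => i _; exact: Lw.
have local j : exists n' (b : 'I_n' -> dual_space g) d s (ki : 'I_n' -> bool),
    chart L Delta (xi j) b d s /\ [/\ forall i, h (b i) = (ki i)%:R,
        forall i, ki i -> exists r, b i = beta j r,
        forall r, exists2 i, ki i & beta j r = b i &
        forall x, Delta x -> h x <= h (xi j) -> F x].
  have [n' [b [Zb coneE]]] := uniD _ (Vxi j).
  have Dxi : Delta (xi j) by exact: FD.
  have [_ [d [s ch]]] := chart_exists cvxD eLb LE dirT Dxi Zb coneE.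
  have [|ki] := face_chart ch F_face (Fxi j) _ (beta_edges j) (hbeta j).
    by move=> x Fx; rewrite !hF.
  by exists n', b, d, s, ki.
split.
- apply: (@primitive_dual_one _ _ _ (beta j0 i0)) => //.
  + by move=> y p; rewrite raddfMn.
  + move=> y Ly; have : range (beta j0) (beta j0 i0) by exists i0.
    by rewrite -beta_edges => -[E [_ _ [Lb _ _] _] _]; exact: Lb.
  + by rewrite -hE hbeta.
- move=> e _ _ [j [i ->]]; rewrite /A /= -hE homD homZ hbeta mulr1.
  by rewrite hF.
pose P e := Delta `&` [set x | h x = cF + e].
have PE e : A e `&` Delta = P e.
  rewrite setIC; congr (_ `&` _); apply/seteqP; split=> x; by rewrite /A /= hE.
have hP j e : Delta `&` [set x | h x = h (xi j) + e] = P e by rewrite hF.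
have ratB : [set` lker h] = Rspan ([set` lker h] `&` L).
  have [n' [b [d [s [ki [ch [hb _ /(_ i0)[i kii _] _]]]]]]] := local j0.
  exact: (section_rational LZ ch hb kii).
(* First threshold, from the sizes of the charts. The last clause, a two-sided move along [beta j r]
   inside [Delta], serves transversality. *)
have [e1 e1_gt0 vertexP] : exists2 t : R, 0 < t & forall j e, 0 < e -> e < t ->
    forall r, let x := xi j + e *: beta j r in
    [/\ P e x, vertex (P e) x,
        exists r' (b : 'I_r' -> dual_space g),
          is_Zbasis (L `&` dir (P e)) b /\ local_cone x (P e) = conic_hull (range b)
      & exists2 t : R, 0 < t & Delta (x + t *: beta j r) /\ Delta (x - t *: beta j r)].
  apply: small_all => j.
  have [n' [b [d [s [ki [ch [hb _ betab _]]]]]]] := local j.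
  have s0 := chart_gt0 ch; exists s => // e e0 es r x.
  have [i kii bE] := betab r; rewrite /x bE -(hP j); split.
  - exact: (section_mem cvxD ch hb e0 kii es).
  - exact: (section_vertex cvxD ch hb e0 kii es).
  - exists n'.-1, (fun q => b (lift i q) - (ki (lift i q))%:R *: b i); split.
      exact: (section_Zbasis cvxD LZ ch hb e0 kii es).
    exact: (section_local_cone cvxD ch hb e0 kii es).
  (* In units of [beta j r], the point lies at distance [e] on a segment of length [s]; the two
     bounds are the distances to its ends. *)
  - exists (Num.min e (s - e)); first by rewrite lt_min e0 subr_gt0.
    have te : Num.min e (s - e) <= e by rewrite ge_min lexx.
    have ts : Num.min e (s - e) <= s - e by rewrite ge_min lexx orbT.
    have t0 : 0 < Num.min e (s - e) by rewrite lt_min e0 subr_gt0.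
    rewrite -addrA -scalerDl -addrA -scalerBl.
    by split; apply: (chart_segment cvxD ch); lra.
(* Second threshold: a generator of [Delta] at level at most [cF] lies in [F], and the finitely many
   others stay above [cF + e] for small [e]. *)
have [e2 e2_gt0 lowS] : exists2 t : R, 0 < t & forall (i : 'I_(size S)) e,
    0 < e -> e < t -> h S`_i <= cF + e -> F S`_i.
  apply: small_all => i; have Si : Delta S`_i.
    by rewrite DS; apply: convex_hull_gen; exact: mem_nth.
  have [low|high] := leP (h S`_i) cF.
    exists 1 => [|e _ _ _]; first exact: ltr01.
    have [n' [b [d [s [ki [ch [_ _ _ lowF]]]]]]] := local j0.
    by apply: lowF => //; rewrite (hF _ (Fxi j0)).
  exists (h S`_i - cF); first by rewrite subr_gt0.
  by move=> e _; rewrite ltrBrDl => he; rewrite leNgt he.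
exists (Num.min e1 e2); first by rewrite lt_min e1_gt0.
move=> e e_gt0; rewrite lt_min => /andP[ee1 ee2]; rewrite !PE.
have ratP : Defs.rational expG (P e).
  by rewrite -PE; apply: rational_setI => //; exact: rational_hyperplane.
have extP x : extreme (P e) x -> V e x.
  move=> ex; have [[Dx hx] _] := ex.
  (* Splitting along [h] provides a vertex of [Delta] with positive weight at level at most
     [cF + e]. Vertices occur in [S], so the second threshold places it in [F]. *)
  have [p [q [a [a01 /extV Vp Hq hp xE]]]] := convex_hull_split h (DV x Dx).
  have Dq : Delta q by move: Hq; apply: sub_hull => y [].
  have : [set` S] p by apply: vertex_convex_hull; rewrite -DS.
  move=> /(nthP 0)[i iS ip]; rewrite hx -ip in hp.
  have Fp := lowS (Ordinal iS) e e_gt0 ee2 hp; rewrite /= ip in Fp.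
  have [j pj] := VF p Vp Fp; rewrite pj in xE.
  have [n' [b [d [s [ki [ch [hb kb _ _]]]]]]] := local j.
  rewrite -(hP j) in ex.
  have [r /kb[r' ->] ->] := extreme_section cvxD ch hb e_gt0 ex a01 Dq xE.
  by exists j, r'.
have VP x : V e x -> P e x.
  by move=> [j [i ->]]; have [] := vertexP j e e_gt0 ee1 i.
have cvxP : convex_set (P e).
  move=> x y a a0 a1 [Dx hx] [Dy hy]; split; first exact: cvxD.
  move: hx hy => /= hx hy; rewrite !homE hx hy; ring.
have PV : P e = convex_hull (V e).
  apply/seteqP; split; last exact: convex_hull_min.
  have [N [lP [cP Ppoly]]] := rational_polyhedron ratP.
  move=> x; rewrite {1}Ppoly => Px.
  have Pbd : polyhedron lP cP `<=` convex_hull [set` S].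
    by rewrite -Ppoly -DS => y [].
  have := convex_hull_extreme Pbd Px; rewrite -Ppoly.
  move: x {Px}; apply: convex_hull_min; first exact: convex_convex_hull.
  by move=> y /extP; exact: convex_hull_gen.
split.
- exists (lker h), (xi j0 + e *: beta j0 i0); split; first exact: ratB.
    apply/seteqP; split=> x.
      rewrite /A /= -hE => hx; exists (x - (xi j0 + e *: beta j0 i0)).
        by rewrite /= memv_ker !homE hbeta (hF _ (Fxi j0)) hx mulr1 subrr.
      by rewrite subrK.
    move=> [y]; rewrite /= memv_ker => /eqP hy <-.
    by rewrite /A /= -hE !homE hy hbeta (hF _ (Fxi j0)) add0r mulr1.
  move=> x; rewrite PE dirT setTI => Px.
  have [u [Lu hu lu]] : exists u, [/\ L u, h u = 1 & local_lin x Delta u].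
    (* Splitting along the zero functional merely extracts a point of [V e] of positive weight
       [a]. *)
    have := Px; rewrite {1}PV => /(convex_hull_split 0)[p [q [a]]].
    move=> [a01 [j [i ->]] Hq _ xE]; exists (beta j i); split.
    + have : range (beta j) (beta j i) by exists i.
      by rewrite -beta_edges => -[E [_ _ [Lb _ _] _] _].
    + exact: hbeta.
    + have [_ _ _ [t t0 [D1 D2]]] := vertexP j e e_gt0 ee1 i.
      have [Dq _] : P e q by rewrite PV.
      have [Dx _] := Px; have /andP[a0 a1] := a01.
      (* Moving the extracted point by [t] times [beta j i] moves [x] by [a * t] times it. *)
      have at0 : a * t != 0 by rewrite mulf_neq0 ?gt_eqF.
      rewrite -[beta j i]scale1r -(mulVf at0) -scalerA.
      have lz v b : local_lin x Delta v -> local_lin x Delta (b *: v).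
        by move=> [H [fH rH vH]]; exists H; split=> //; exact: lin_hullZ.
      apply: lz; rewrite Dpoly; apply: local_lin_polyhedron; rewrite -?Dpoly //.
        have -> : x + (a * t) *: beta j i =
            a *: (xi j + e *: beta j i + t *: beta j i) + (1 - a) *: q.
          by apply: hom_ext => l; rewrite xE !homE; ring.
        by apply: cvxD => //; exact: ltW.
      have -> : x - (a * t) *: beta j i =
          a *: (xi j + e *: beta j i - t *: beta j i) + (1 - a) *: q.
        by apply: hom_ext => l; rewrite xE !homE; ring.
      by apply: cvxD => //; exact: ltW.
  apply/seteqP; split=> _ [y [hy Ly] [z Hz <-]].
    by exists y => //; exists z => //; case: Hz.
  have LZ1 v (a : R) : a \is a Num.int -> L v -> L (a *: v).
    by move=> aZ Lv; apply: LZ; exact: lin_hull_gen.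
  have LD v v' : L v -> L v' -> L (v + v').
    by move=> Lv Lv' ? Lx; rewrite add_lfunE rpredD ?Lv ?Lv'.
  have hz : h z \is a Num.int by rewrite hE; exact: Hz.
  (* Subtracting [h z] times [u] brings [z] into the kernel of [h]; the coefficient is an integer,
     so both parts stay in the lattice. *)
  exists (y + (z - (h z : R) *: u)).
    split.
      move: hy; rewrite /= !memv_ker => /eqP hy.
      by rewrite !homE hy hu mulr1 subrr addr0.
    apply: (LD _ _ Ly); apply: (LD _ _ Hz); rewrite -scaleNr.
    by apply: LZ1 => //; rewrite rpredN.
  exists ((h z : R) *: u); last by rewrite -addrA subrK.
  split; last exact: LZ1.
  by have [H [fH rH vH]] := lu; exists H; split=> //; exact: lin_hullZ.
- split=> //; last first.
    move=> x; rewrite {1}PV => /vertex_convex_hull[j [i ->]].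
    by have [] := vertexP j e e_gt0 ee1 i.
  exists [seq xi j + e *: beta j i | j <- enum 'I_m, i <- enum 'I_(n - k)].
  rewrite PV; congr convex_hull; apply/seteqP; split=> x /=.
    by move=> [j [i ->]]; apply/allpairsP; exists (j, i); rewrite !mem_enum.
  by move=> /allpairsP[[j i] [_ _ ->]]; exists j, i.
- apply/seteqP; split=> x.
    by rewrite /= {1}PV => /vertex_convex_hull.
  by move=> [j [i ->]]; have [] := vertexP j e e_gt0 ee1 i.
Qed.
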